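(* Let $\Gamma_{33},\Gamma_{35},\Gamma_{97},\Gamma_{152},\Gamma_{153},\Gamma_{243},\Gamma_{248},\Gamma_{250},\Gamma_{266}\subset \mathrm{GL}(4,\mathbb{Q})$ be the monodromy groups of the double octic orphan operators, given by the explicit generators listed in the context. Then: (1) Each of these nine groups is Zariski-dense in the symplectic group: for each index $j\in\{33,35,97,152,153,243,248,250,266\}$ there is $T\in\mathrm{GL}(4,\mathbb{Q})$ such that $T^{-1}\Gamma_jT\subset\mathrm{Sp}(4,\mathbb{Q})$ and $T^{-1}\Gamma_jT$ is Zariski-dense in $\mathrm{Sp}_4$. (2) For each $j\in\{33,97,152,153,243,248,250,266\}$ (i.e. all except possibly $j=35$) the group $\Gamma_j$ contains a maximally unipotent element. (3) The monodromy group of operator $\mathbf{250}$ is of finite index in $\mathrm{Sp}(4,\mathbb{Z})$: with the matrix $T_{250}$ given in the context, $T_{250}^{-1}\Gamma_{250}T_{250}$ is a subgroup of finite index in $\mathrm{Sp}(4,\mathbb{Z})$.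
   Context: Conventions. Matrices act on column vectors. $\mathrm{Sp}(4,R)$ is the group of $4\times4$ matrices over $R$ preserving the alternating form with Gram matrix $\Omega=\begin{pmatrix}0&\mathrm{Id}_2\\-\mathrm{Id}_2&0\end{pmatrix}$. A matrix $A\in\mathrm{GL}(4,\mathbb{Q})$ is maximally unipotent if $(A-\mathrm{Id})^4=0$ and $(A-\mathrm{Id})^3\neq0$ (its Jordan form is a single $4\times 4$ block with eigenvalue $1$). Origin of the groups. A double octic is a smooth Calabi-Yau threefold obtained by resolving the singularities of a double cover of $\mathbb{P}^3$ branched along a union of eight planes. A double octic operator is a Picard-Fuchs operator of a one-parameter family of double octics $X_t$ defined over $\mathbb{Q}$ with $h^{2,1}(X_t)=1$. An orphan operator is one with no singular point of maximal unipotent monodromy (no singular point whose local monodromy is maximally unipotent). Up to equivalence of operators, the double octic orphan operators of order $4$ are the nine operators $\mathbf{33},\mathbf{35},\mathbf{97},\mathbf{152},\mathbf{153},\mathbf{243},\mathbf{248},\mathbf{250},\mathbf{266}$ (numbered by the corresponding arrangement of eight planes). Their monodromy groups are generated by local monodromy operators which, written in a rational basis of the solution space (and determined numerically), are the following matrices; $\Gamma_j$ denotes the subgroup of $\mathrm{GL}(4,\mathbb{Q})$ generated by the matrices listed for operator $j$. $\Gamma_{33}$: $\begin{pmatrix}-1&-4&-24&16\\0&2&2&4\\0&-1&-1&-4\\0&-\frac14&-\frac12&0\end{pmatrix}$, $\begin{pmatrix}1&0&0&0\\1&1&0&0\\0&0&1&0\\0&0&1&1\end{pmatrix}$, $\begin{pmatrix}1&0&0&0\\0&1&0&0\\-\frac12&1&1&12\\0&0&0&1\end{pmatrix}$.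 $\Gamma_{35}$: $\begin{pmatrix}-1&-24&32&-512\\0&3&-8&32\\0&\frac12&-1&8\\0&-\frac18&\frac12&-1\end{pmatrix}$, $\begin{pmatrix}1&0&0&0\\1&1&0&0\\0&0&1&0\\0&0&1&1\end{pmatrix}$, $\begin{pmatrix}1&0&0&0\\0&1&0&0\\\frac14&1&1&32\\0&0&0&1\end{pmatrix}$. $\Gamma_{97}$: $\begin{pmatrix}-3&0&0&-32\\2&1&0&16\\-\frac12&1&-1&-8\\\frac14&0&0&3\end{pmatrix}$, $\begin{pmatrix}1&4&-16&0\\0&1&0&0\\0&0&1&0\\0&0&0&1\end{pmatrix}$, $\begin{pmatrix}1&0&0&0\\1&1&0&0\\0&0&1&0\\0&0&1&1\end{pmatrix}$. $\Gamma_{152}$: $\begin{pmatrix}-1&-4&32&-64\\0&1&0&0\\0&\frac12&-1&0\\0&\frac18&-\frac12&1\end{pmatrix}$, $\begin{pmatrix}-3&0&0&-128\\1&1&0&32\\-\frac14&1&-1&-16\\\frac1{16}&0&0&3\end{pmatrix}$, $\begin{pmatrix}1&0&0&0\\1&1&0&0\\0&0&1&0\\0&0&1&1\end{pmatrix}$. $\Gamma_{153}$: $\begin{pmatrix}1&0&0&0\\1&1&0&32\\0&0&1&0\\0&-\frac18&1&-3\end{pmatrix}$, $\begin{pmatrix}-1&-68&448&-2368\\0&-\frac{91}3&\frac{470}3&-\frac{3008}3\\0&\frac43&-\frac{17}3&\frac{128}3\\0&\frac98&-\frac{45}8&37\end{pmatrix}$, $\begin{pmatrix}-9&0&0&-512\\-\frac{25}6&1&0&-\frac{640}3\\\frac16&1&-1&\frac{112}3\\\frac5{32}&0&0&9\end{pmatrix}$.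 $\Gamma_{243}$: $\begin{pmatrix}-1&-204&360&-14880\\0&\frac{43}4&-\frac{65}2&650\\0&\frac9{10}&-2&60\\0&-\frac{21}{160}&\frac7{16}&-\frac{31}4\end{pmatrix}$, $\begin{pmatrix}-2&-12&-120&-1440\\-\frac9{16}&-\frac54&-\frac{45}2&-270\\\frac3{40}&\frac3{10}&4&36\\\frac3{640}&\frac3{160}&\frac3{16}&\frac{13}4\end{pmatrix}$, $\begin{pmatrix}1&0&0&0\\0&1&0&0\\\frac1{20}&1&1&88\\0&0&0&1\end{pmatrix}$, $\begin{pmatrix}-1&0&0&0\\-\frac12&-1&0&0\\0&0&-1&0\\0&0&-\frac12&-1\end{pmatrix}$. $\Gamma_{248}$: $\begin{pmatrix}1&0&0&0\\0&1&0&0\\-\frac12&1&1&16\\0&0&0&1\end{pmatrix}$, $\begin{pmatrix}1&4&16&32\\0&1&0&0\\0&0&1&0\\0&0&0&1\end{pmatrix}$, $\begin{pmatrix}1&0&0&0\\1&1&0&0\\0&0&1&0\\0&0&1&1\end{pmatrix}$, $\begin{pmatrix}3&4&32&32\\-1&-1&-16&-16\\0&0&1&0\\0&0&0&1\end{pmatrix}$, $\begin{pmatrix}17&16&128&0\\-8&-7&-64&0\\-1&-1&-7&0\\\frac12&\frac12&4&1\end{pmatrix}$. $\Gamma_{250}$: $\begin{pmatrix}1&-8&64&-128\\0&1&0&0\\0&0&1&0\\0&0&0&1\end{pmatrix}$, $\begin{pmatrix}1&-4&0&0\\1&-3&0&0\\0&0&1&-4\\0&0&1&-3\end{pmatrix}$,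 $\begin{pmatrix}-1&24&-80&224\\0&7&-24&80\\\frac38&\frac34&-5&28\\\frac1{16}&-\frac38&1&-1\end{pmatrix}$, $\begin{pmatrix}1&0&0&0\\0&1&0&0\\-\frac12&1&1&-8\\0&0&0&1\end{pmatrix}$; and $T_{250}=\begin{pmatrix}32&-16&0&0\\16&0&0&16\\0&0&-2&0\\-1&0&-1&0\end{pmatrix}$. $\Gamma_{266}$: $\begin{pmatrix}1&0&0&0\\0&1&0&0\\1&-6&1&-3\\0&0&0&1\end{pmatrix}$, $\begin{pmatrix}1&-\frac{12}5&\frac{24}5&\frac{12}5\\1&-\frac{11}5&-\frac85&-\frac{24}5\\0&\frac35&-\frac15&-\frac35\\0&-\frac25&\frac45&\frac75\end{pmatrix}$, $\begin{pmatrix}1&12&-16&0\\0&1&0&0\\0&0&1&0\\0&0&0&1\end{pmatrix}$, $\begin{pmatrix}1&\frac{96}5&-\frac{48}5&0\\0&\frac{13}5&-\frac45&0\\0&\frac{36}5&-\frac{13}5&0\\1&\frac{16}5&-\frac{28}5&-1\end{pmatrix}$, $\begin{pmatrix}5&-12&-16&-12\\0&1&0&0\\1&-3&-3&-3\\0&0&0&1\end{pmatrix}$. *)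

(* Defs.v *)
From mathcomp Require Import all_boot all_order all_algebra all_field.
From mathcomp Require Import mpoly.

Set Implicit Arguments.
Unset Strict Implicit.
Unset Printing Implicit Defensive.

Import GRing.Theory.
Local Open Scope ring_scope.

(** Subgroups of [GL(n, K)] are given as predicates on ['M[K]_n]. *)

Definition is_subgroup (K : fieldType) (n : nat) (G : 'M[K]_n -> Prop) : Prop :=
  [/\ forall A, G A -> A \in unitmx,
      G 1%:M,
      forall A B, G A -> G B -> G (A *m B)
    & forall A, G A -> G (invmx A)].

(** The group generated by [s]; it consists of invertible matrices when all
    members of [s] are invertible. *)
Inductive generated (K : fieldType) (n : nat) (s : seq 'M[K]_n) :
    'M[K]_n -> Prop :=
  | gen_one : generated s 1%:M
  | gen_mem A : A \in s -> generated s A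
  | gen_mul A B : generated s A -> generated s B -> generated s (A *m B)
  | gen_inv A : generated s A -> generated s (invmx A).

(** [T^-1 G T] *)
Definition conjugate (K : fieldType) (n : nat) (T : 'M[K]_n)
    (G : 'M[K]_n -> Prop) (B : 'M[K]_n) : Prop :=
  exists2 A, G A & B = invmx T *m A *m T.

(** Finite index: the left cosets [r H], for [r \in reps], cover [G]. *)
Definition finite_index_subgroup (K : fieldType) (n : nat)
    (H G : 'M[K]_n -> Prop) : Prop :=
  [/\ is_subgroup H, is_subgroup G, forall A, H A -> G A
    & exists2 reps : seq 'M[K]_n, forall r, r \in reps -> G r
      & forall A, G A -> exists2 r, r \in reps & H (invmx r *m A)].

Definition maximally_unipotent (A : 'M[rat]_4) : Prop :=
  [/\ A \in unitmx, (A - 1) ^+ 4 = 0 & (A - 1) ^+ 3 <> 0].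

Definition Omega (R : comNzRingType) : 'M[R]_4 :=
  block_mx (0 : 'M[R]_2) 1%:M (- 1%:M) 0.

(** [Sp(4, R)]: invertibility follows from the equation, as [Omega] has
    determinant 1. *)
Definition Sp4 (R : comNzRingType) (A : 'M[R]_4) : Prop :=
  A^T *m Omega R *m A = Omega R.

(** [Sp(4, Z)] as a subset of ['M[rat]_4]. *)
Definition Sp4Z (A : 'M[rat]_4) : Prop :=
  exists2 B : 'M[int]_4, Sp4 B & A = map_mx intr B.

(** Zariski topology on the affine space of [n] x [n] matrices over [K], a
    polynomial in [n * n] variables being evaluated at the entries of the
    matrix. *)
Definition zariski_closed (K : fieldType) (n : nat) (Z : 'M[K]_n -> Prop) :
    Prop :=
  exists P : {mpoly K[n * n]} -> Prop,
    forall A, Z A <-> (forall p, P p -> p.@[fun i => mxvec A 0 i] = 0).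

Definition zariski_dense_in (K : fieldType) (n : nat) (S X : 'M[K]_n -> Prop) :
    Prop :=
  (forall A, S A -> X A) /\
  (forall Z : 'M[K]_n -> Prop, zariski_closed Z ->
     (forall A, S A -> Z A) -> forall A, X A -> Z A).

(** Zariski density of a set of rational matrices in the algebraic group
    [Sp_4], taken over the algebraic closure [algC] of the rationals. *)
Definition zariski_dense_in_Sp4 (G : 'M[rat]_4 -> Prop) : Prop :=
  zariski_dense_in
    (fun B : 'M[algC]_4 => exists2 A, G A & B = map_mx ratr A)
    (@Sp4 algC).

Definition mx_of_rows (rows : seq (seq rat)) : 'M[rat]_4 :=
  \matrix_(i < 4, j < 4) nth 0 (nth [::] rows i) j.

Definition generators_33 : seq 'M[rat]_4 :=
  [:: mx_of_rows
        [:: [:: -1;   -4;  -24; 16];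
            [::  0;    2;    2;  4];
            [::  0;   -1;   -1; -4];
            [::  0; -1/4; -1/2;  0]];
      mx_of_rows
        [:: [:: 1; 0; 0; 0];
            [:: 1; 1; 0; 0];
            [:: 0; 0; 1; 0];
            [:: 0; 0; 1; 1]];
      mx_of_rows
        [:: [::    1; 0; 0;  0];
            [::    0; 1; 0;  0];
            [:: -1/2; 1; 1; 12];
            [::    0; 0; 0;  1]]].

Definition generators_35 : seq 'M[rat]_4 :=
  [:: mx_of_rows
        [:: [:: -1;  -24;  32; -512];
            [::  0;    3;  -8;   32];
            [::  0;  1/2;  -1;    8];
            [::  0; -1/8; 1/2;   -1]];
      mx_of_rows
        [:: [:: 1; 0; 0; 0];
            [:: 1; 1; 0; 0];
            [:: 0; 0; 1; 0];
            [:: 0; 0; 1; 1]];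
      mx_of_rows
        [:: [::   1; 0; 0;  0];
            [::   0; 1; 0;  0];
            [:: 1/4; 1; 1; 32];
            [::   0; 0; 0;  1]]].

Definition generators_97 : seq 'M[rat]_4 :=
  [:: mx_of_rows
        [:: [::   -3; 0;  0; -32];
            [::    2; 1;  0;  16];
            [:: -1/2; 1; -1;  -8];
            [::  1/4; 0;  0;   3]];
      mx_of_rows
        [:: [:: 1; 4; -16; 0];
            [:: 0; 1;   0; 0];
            [:: 0; 0;   1; 0];
            [:: 0; 0;   0; 1]];
      mx_of_rows
        [:: [:: 1; 0; 0; 0];
            [:: 1; 1; 0; 0];
            [:: 0; 0; 1; 0];
            [:: 0; 0; 1; 1]]].

Definition generators_152 : seq 'M[rat]_4 :=
  [:: mx_of_rows
        [:: [:: -1;  -4;   32; -64];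
            [::  0;   1;    0;   0];
            [::  0; 1/2;   -1;   0];
            [::  0; 1/8; -1/2;   1]];
      mx_of_rows
        [:: [::   -3; 0;  0; -128];
            [::    1; 1;  0;   32];
            [:: -1/4; 1; -1;  -16];
            [:: 1/16; 0;  0;    3]];
      mx_of_rows
        [:: [:: 1; 0; 0; 0];
            [:: 1; 1; 0; 0];
            [:: 0; 0; 1; 0];
            [:: 0; 0; 1; 1]]].

Definition generators_153 : seq 'M[rat]_4 :=
  [:: mx_of_rows
        [:: [:: 1;    0; 0;  0];
            [:: 1;    1; 0; 32];
            [:: 0;    0; 1;  0];
            [:: 0; -1/8; 1; -3]];
      mx_of_rows
        [:: [:: -1;   -68;   448;   -2368];
            [::  0; -91/3; 470/3; -3008/3];
            [::  0;   4/3; -17/3;   128/3];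
            [::  0;   9/8; -45/8;      37]];
      mx_of_rows
        [:: [::    -9; 0;  0;   -512];
            [:: -25/6; 1;  0; -640/3];
            [::   1/6; 1; -1;  112/3];
            [::  5/32; 0;  0;      9]]].

Definition generators_243 : seq 'M[rat]_4 :=
  [:: mx_of_rows
        [:: [:: -1;    -204;   360; -14880];
            [::  0;    43/4; -65/2;    650];
            [::  0;    9/10;    -2;     60];
            [::  0; -21/160;  7/16;  -31/4]];
      mx_of_rows
        [:: [::    -2;   -12;  -120; -1440];
            [:: -9/16;  -5/4; -45/2;  -270];
            [::  3/40;  3/10;     4;    36];
            [:: 3/640; 3/160;  3/16;  13/4]];
      mx_of_rows
        [:: [::    1; 0; 0;  0];
            [::    0; 1; 0;  0];
            [:: 1/20; 1; 1; 88];
            [::    0; 0; 0;  1]];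
      mx_of_rows
        [:: [::   -1;  0;    0;  0];
            [:: -1/2; -1;    0;  0];
            [::    0;  0;   -1;  0];
            [::    0;  0; -1/2; -1]]].

Definition generators_248 : seq 'M[rat]_4 :=
  [:: mx_of_rows
        [:: [::    1; 0; 0;  0];
            [::    0; 1; 0;  0];
            [:: -1/2; 1; 1; 16];
            [::    0; 0; 0;  1]];
      mx_of_rows
        [:: [:: 1; 4; 16; 32];
            [:: 0; 1;  0;  0];
            [:: 0; 0;  1;  0];
            [:: 0; 0;  0;  1]];
      mx_of_rows
        [:: [:: 1; 0; 0; 0];
            [:: 1; 1; 0; 0];
            [:: 0; 0; 1; 0];
            [:: 0; 0; 1; 1]];
      mx_of_rows
        [:: [::  3;  4;  32;  32];
            [:: -1; -1; -16; -16];
            [::  0;  0;   1;   0];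
            [::  0;  0;   0;   1]];
      mx_of_rows
        [:: [::  17;  16; 128; 0];
            [::  -8;  -7; -64; 0];
            [::  -1;  -1;  -7; 0];
            [:: 1/2; 1/2;   4; 1]]].

Definition generators_250 : seq 'M[rat]_4 :=
  [:: mx_of_rows
        [:: [:: 1; -8; 64; -128];
            [:: 0;  1;  0;    0];
            [:: 0;  0;  1;    0];
            [:: 0;  0;  0;    1]];
      mx_of_rows
        [:: [:: 1; -4; 0;  0];
            [:: 1; -3; 0;  0];
            [:: 0;  0; 1; -4];
            [:: 0;  0; 1; -3]];
      mx_of_rows
        [:: [::   -1;   24; -80; 224];
            [::    0;    7; -24;  80];
            [::  3/8;  3/4;  -5;  28];
            [:: 1/16; -3/8;   1;  -1]];
      mx_of_rows
        [:: [::    1; 0; 0;  0];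
            [::    0; 1; 0;  0];
            [:: -1/2; 1; 1; -8];
            [::    0; 0; 0;  1]]].

Definition generators_266 : seq 'M[rat]_4 :=
  [:: mx_of_rows
        [:: [:: 1;  0; 0;  0];
            [:: 0;  1; 0;  0];
            [:: 1; -6; 1; -3];
            [:: 0;  0; 0;  1]];
      mx_of_rows
        [:: [:: 1; -12/5; 24/5;  12/5];
            [:: 1; -11/5; -8/5; -24/5];
            [:: 0;   3/5; -1/5;  -3/5];
            [:: 0;  -2/5;  4/5;   7/5]];
      mx_of_rows
        [:: [:: 1; 12; -16; 0];
            [:: 0;  1;   0; 0];
            [:: 0;  0;   1; 0];
            [:: 0;  0;   0; 1]];
      mx_of_rows
        [:: [:: 1; 96/5; -48/5;  0];
            [:: 0; 13/5;  -4/5;  0];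
            [:: 0; 36/5; -13/5;  0];
            [:: 1; 16/5; -28/5; -1]];
      mx_of_rows
        [:: [:: 5; -12; -16; -12];
            [:: 0;   1;   0;   0];
            [:: 1;  -3;  -3;  -3];
            [:: 0;   0;   0;   1]]].

Definition T250 : 'M[rat]_4 :=
  mx_of_rows
    [:: [:: 32; -16;  0;  0];
        [:: 16;   0;  0; 16];
        [::  0;   0; -2;  0];
        [:: -1;   0; -1;  0]].

(** The double octic orphan operators of order 4, up to equivalence. *)
Inductive orphan_operator : Set :=
  | op33 | op35 | op97 | op152 | op153 | op243 | op248 | op250 | op266.

Definition generators (j : orphan_operator) : seq 'M[rat]_4 :=
  match j with
  | op33 => generators_33
  | op35 => generators_35
  | op97 => generators_97
  | op152 => generators_152
  | op153 => generators_153
  | op243 => generators_243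
  | op248 => generators_248
  | op250 => generators_250
  | op266 => generators_266
  end.

Definition Gamma (j : orphan_operator) : 'M[rat]_4 -> Prop :=
  generated (generators j).

(* Main.v *)
From Stdlib Require Import ZArith Classical_Prop.
Require Import Defs.
From mathcomp Require Import all_boot all_order all_algebra all_field.
From mathcomp Require Import mpoly ring lra zify ssrZ.

Set Implicit Arguments.
Unset Strict Implicit.
Unset Printing Implicit Defensive.

Import Order.TTheory GRing.Theory Num.Theory.
Local Open Scope ring_scope.
Delimit Scope Z_scope with coqZ.

(** Density and finite index both come from the supply of transvections
    [x |-> x + a * spform v x * v] in the groups.

    Density.  A Zariski closed set containing [1 + k * n * X] for every natural
    number [n] contains the line [1 + t * X], because a polynomial in one
    variable with infinitely many roots is zero.  So the closure of a group
    that contains one nontrivial transvection along [v] contains all of them,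
    and since the closure is stable under products, the set of such directions
    [v] is stable under the group they generate.  Each of the nine groups,
    written in a suitable rational symplectic basis [e1, e2, f1, f2], contains
    transvections along [e1], [f1], [a e1 + e2 + b f1] and [c e1 + d f1 + f2]
    with [(a, b)] and [(c, d)] nonzero.  The first two generate the special
    linear group of the plane [e1, f1], which moves the other two directions to
    [e1 + e2] and [e1 + f2]; from these the closure gets all root subgroups
    ([transv_density]), and Gaussian elimination with root elements reaches
    every symplectic matrix ([field_fill]).

    Unipotence.  For each of the eight groups an explicit word in the
    generators is maximally unipotent.

    Finite index.  In the frame [T250] the generators of the group of operator
    250 are integral.  In a further symplectic basis of the integral lattice
    the group contains the root elements of all eight types used below with
    coefficient in [N] times the integers, [N = 2048], the transvections along
    [e1] with even coefficient, and sixteen special matrices of determinant 1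
    acting on the plane [e1, f1].  The latter carry out a Euclidean algorithm:
    with the transvections along [e1] they reduce every primitive pair
    congruent to [(1, 0)] modulo 8 to [(1, 0)] ([plane_reduce]). A matrix
    congruent to 1 modulo [N ^ 2] is then reduced to 1 inside the group
    ([congruence_fill]): root elements of level [N] bring the image of [e2]
    back to [e2] (a stable range argument, where one coordinate is made
    coprime to another), and what remains in the stabilizer of [e2] is a
    matrix of the plane [e1, f1], handled by the Euclidean algorithm, times
    root elements. So the group contains a principal congruence subgroup of
    the integral symplectic group, whose cosets are counted by residue
    matrices.

    The explicit matrices are handled by computation: a rational matrix is
    stored as an integral matrix with a common denominator, and each
    certificate is a boolean evaluated by the kernel. *)

(** * The symplectic form and its transvections *)

Section Transvections.
Variable R : comNzRingType.
Implicit Types (a b t : R) (v w x y : 'cV[R]_4) (A B : 'M[R]_4).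

(** Coordinates are with respect to a symplectic basis [e1, e2, f1, f2]. *)
Definition col4 (x1 x2 y1 y2 : R) : 'cV[R]_4 :=
  \col_i nth 0 [:: x1; x2; y1; y2] i.

Definition spform v w : R := (v^T *m Omega R *m w) 0 0.

Definition transv a v : 'M[R]_4 := 1%:M + a *: (v *m (v^T *m Omega R)).

(** Symplectic when [v] and [w] are orthogonal; for two orthogonal basis vectors
    these are the short root elements. *)
Definition short a v w : 'M[R]_4 :=
  1%:M + a *: (v *m (w^T *m Omega R) + w *m (v^T *m Omega R)).

Lemma mul_outer v w x : v *m (w^T *m Omega R) *m x = spform w x *: v.
Proof. by rewrite -mulmxA [w^T *m _ *m x]mx11_scalar mul_mx_scalar. Qed.

Lemma transvE a v x : transv a v *m x = x + (a * spform v x) *: v.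
Proof. by rewrite mulmxDl mul1mx -scalemxAl mul_outer scalerA. Qed.

Lemma shortE a v w x :
  short a v w *m x = x + (a * spform w x) *: v + (a * spform v x) *: w.
Proof.
by rewrite mulmxDl mul1mx -scalemxAl mulmxDl !mul_outer scalerDr !scalerA addrA.
Qed.

Lemma col4P x : x = col4 (x 0 0) (x 1 0) (x 2 0) (x 3 0).
Proof.
apply/matrixP=> i j; rewrite !mxE !ord1.
case: i => [] [|[|[|[|//]]]] Hi /=; congr (x _ _); exact: val_inj.
Qed.

Lemma eq_col4 (x1 x2 y1 y2 x1' x2' y1' y2' : R) : x1 = x1' -> x2 = x2' -> y1 = y1' ->
  y2 = y2' -> col4 x1 x2 y1 y2 = col4 x1' x2' y1' y2'.
Proof. by move=> -> -> -> ->. Qed.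

Lemma col4D (x1 x2 y1 y2 x1' x2' y1' y2' : R) :
  col4 x1 x2 y1 y2 + col4 x1' x2' y1' y2' =
  col4 (x1 + x1') (x2 + x2') (y1 + y1') (y2 + y2').
Proof.
apply/matrixP=> i j; rewrite !mxE.
by case: i => [] [|[|[|[|//]]]].
Qed.

Lemma col4Z a (x1 x2 y1 y2 : R) :
  a *: col4 x1 x2 y1 y2 = col4 (a * x1) (a * x2) (a * y1) (a * y2).
Proof.
apply/matrixP=> i j; rewrite !mxE.
by case: i => [] [|[|[|[|//]]]].
Qed.

Lemma Omega_col4 (x1 x2 y1 y2 : R) :
  Omega R *m col4 x1 x2 y1 y2 = col4 y1 y2 (- x1) (- x2).
Proof.
pose x : 'M[R]_(2, 1) := \col_i nth 0 [:: x1; x2] i.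
pose y : 'M[R]_(2, 1) := \col_i nth 0 [:: y1; y2] i.
have mulO : (Omega R : 'M_(2 + 2)) *m col_mx x y = col_mx y (- x).
  by rewrite mul_block_col !mul0mx mulNmx !mul1mx add0r addr0.
have -> : col4 x1 x2 y1 y2 = col_mx x y.
  apply/matrixP=> i j; rewrite !mxE.
  by case: splitP => -[] [|[|//]] //= ? ->; rewrite mxE.
apply: (etrans mulO); apply/matrixP=> i j; rewrite !mxE.
by case: splitP => -[] [|[|//]] //= ? ->; rewrite !mxE.
Qed.

Lemma formE (x1 x2 y1 y2 x1' x2' y1' y2' : R) :
  spform (col4 x1 x2 y1 y2) (col4 x1' x2' y1' y2') =
  x1 * y1' + x2 * y2' - y1 * x1' - y2 * x2'.
Proof.
rewrite /spform -mulmxA Omega_col4 !mxE !big_ord_recl big_ord0 !mxE /=; ring.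
Qed.

Lemma formZl a v w : spform (a *: v) w = a * spform v w.
Proof. by rewrite /spform linearZ -!scalemxAl mxE. Qed.

Lemma formZr a v w : spform v (a *: w) = a * spform v w.
Proof. by rewrite /spform -scalemxAr mxE. Qed.

Lemma formDl v v' w : spform (v + v') w = spform v w + spform v' w.
Proof. by rewrite /spform linearD !mulmxDl mxE. Qed.

Lemma formDr v w w' : spform v (w + w') = spform v w + spform v w'.
Proof. by rewrite /spform mulmxDr mxE. Qed.

Lemma formvv v : spform v v = 0.
Proof. by rewrite (col4P v) formE; ring. Qed.

Lemma formC v w : spform w v = - spform v w.
Proof. by rewrite (col4P v) (col4P w) !formE; ring. Qed.

Lemma eq_mulcol A B : (forall x : 'cV[R]_4, A *m x = B *m x) -> A = B.
Proof.
move=> eqAB; apply/matrixP=> i j.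
by have /matrixP/(_ i 0) := eqAB (delta_mx j 0); rewrite -!colE !mxE.
Qed.

Lemma Sp4_form A v w : Sp4 A -> spform (A *m v) (A *m w) = spform v w.
Proof.
move=> spA; rewrite /spform trmx_mul !mulmxA -(mulmxA v^T A^T).
by rewrite -(mulmxA v^T _ A) spA.
Qed.

Lemma Sp4P A : (forall v w, spform (A *m v) (A *m w) = spform v w) -> Sp4 A.
Proof.
move=> formA; apply/matrixP=> i j.
have entry (M : 'M[R]_4) :
    ((delta_mx i 0 : 'cV_4)^T *m M *m (delta_mx j 0 : 'cV_4)) 0 0 = M i j.
  by rewrite trmx_delta -rowE -colE !mxE.
rewrite -[LHS]entry -[RHS]entry -[RHS]/(spform _ _) -formA.
by rewrite /spform trmx_mul !mulmxA.
Qed.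

Lemma Sp4_1 : Sp4 (1%:M : 'M[R]_4).
Proof. by apply: Sp4P => v w; rewrite !mul1mx. Qed.

Lemma Sp4_mul A B : Sp4 A -> Sp4 B -> Sp4 (A *m B).
Proof. by move=> spA spB; apply: Sp4P => v w; rewrite -!mulmxA !Sp4_form. Qed.

Lemma Sp4_transv a v : Sp4 (transv a v).
Proof.
apply: Sp4P => x y; rewrite !transvE !(formDl, formDr, formZl, formZr) formvv.
by rewrite (formC v x); ring.
Qed.

Lemma transv0 v : transv 0 v = 1%:M.
Proof. by rewrite /transv scale0r addr0. Qed.

Lemma transvD a b v : transv a v *m transv b v = transv (a + b) v.
Proof.
apply: eq_mulcol => x; rewrite -mulmxA !transvE formDr formZr formvv !mulr0 addr0.
by rewrite -addrA -scalerDl -mulrDl [b + a]addrC.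
Qed.

Lemma transvZ a b v : transv a (b *: v) = transv (a * b ^+ 2) v.
Proof.
by apply: eq_mulcol => x; rewrite !transvE formZl scalerA; congr (_ + _ *: _); ring.
Qed.

Lemma transv_conj A a v : Sp4 A ->
  A *m transv a v = transv a (A *m v) *m A.
Proof.
move=> spA; apply: eq_mulcol => x.
by rewrite -!mulmxA !transvE Sp4_form // mulmxDr -scalemxAr.
Qed.

Lemma shortD a b v w : spform v w = 0 ->
  short a v w *m short b v w = short (a + b) v w.
Proof.
move=> vw0; have wv0 : spform w v = 0 by rewrite formC vw0 oppr0.
apply: eq_mulcol => x; rewrite -mulmxA !shortE !formDr !formZr !formvv vw0 wv0.
by rewrite !(mulr0, addr0); apply/matrixP=> i j; rewrite !mxE; ring.
Qed.

(** Polarization: the quadratic map [v |-> transv a v] turns the sum [v + w]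
    of orthogonal vectors into a product with one mixed factor. *)
Lemma short_transv a v w : spform v w = 0 ->
  short a v w = transv a (v + w) *m transv (- a) v *m transv (- a) w.
Proof.
move=> vw0; have wv0 : spform w v = 0 by rewrite formC vw0 oppr0.
apply: eq_mulcol => x; rewrite -!mulmxA !transvE !shortE.
rewrite !(formDr, formZr, formDl, formZl) !formvv vw0 wv0 !(mulr0, addr0, add0r).
by apply/matrixP=> i j; rewrite !mxE; ring.
Qed.

(** The inverse of [A] when [A] is symplectic; it only permutes the entries of
    [A] up to sign, so it makes sense over any ring and commutes with ring
    morphisms. *)
Definition adjsp A : 'M[R]_4 := - (Omega R *m A^T *m Omega R).

Lemma Omega2 : Omega R *m Omega R = - 1%:M.
Proof.
apply: eq_mulcol => x; rewrite (col4P x) -mulmxA !Omega_col4 mulNmx mul1mx.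
by rewrite -scaleN1r col4Z; apply: eq_col4; ring.
Qed.

Lemma adjspK A : Sp4 A -> adjsp A *m A = 1%:M.
Proof.
move=> spA; rewrite /adjsp mulNmx -!mulmxA (mulmxA A^T) [A^T *m _ *m A]spA.
by rewrite Omega2 opprK.
Qed.

Lemma adjspKr A : Sp4 A -> A *m adjsp A = 1%:M.
Proof. by move=> spA; apply: mulmx1C; apply: adjspK. Qed.

Lemma Sp4_adjsp A : Sp4 A -> Sp4 (adjsp A).
Proof.
by move=> spA; apply: Sp4P => v w; rewrite -(Sp4_form _ _ spA) !mulmxA adjspKr ?mul1mx.
Qed.

End Transvections.

(** * Zariski closure of a set of matrices *)

Section Zariski.
Variables (K : numFieldType) (n : nat).
Implicit Types (A B : 'M[K]_n) (S Z : 'M[K]_n -> Prop).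

Definition zariski_closure S A : Prop :=
  forall Z, zariski_closed Z -> (forall B, S B -> Z B) -> Z A.

(** Composing the defining polynomials with the linear forms that give the
    coordinates of [f A] defines the preimage. *)
Lemma closed_preimage (f : {linear 'M[K]_n -> 'M[K]_n}) Z :
  zariski_closed Z -> zariski_closed (fun A => Z (f A)).
Proof.
case=> P defZ.
pose lin : (n * n).-tuple {mpoly K[n * n]} := [tuple \sum_j lin_mx f j i *: 'X_j | i < n * n].
exists (fun q => exists2 p, P p & q = p \mPo lin) => A.
have evalq p : (p \mPo lin).@[fun i => mxvec A 0 i] = p.@[fun i => mxvec (f A) 0 i].
  rewrite comp_mpoly_meval; apply: meval_eq => i.
  rewrite tnth_mktuple raddf_sum /= -mul_vec_lin mxE; apply: eq_bigr => j _.
  by rewrite mevalZ mevalXU mulrC.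
split=> [/defZ Pf q [p Pp ->] | PfA]; first by rewrite evalq; apply: Pf.
by apply/defZ => p Pp; rewrite -evalq; apply: PfA; exists p.
Qed.

(** Fix the right factor in the closure and let the left factor vary, after
    the same step with the sides exchanged: left and right multiplications are
    linear, so preimages of closed sets under them are closed. *)
Lemma closure_mul S : (forall A B, S A -> S B -> S (A *m B)) ->
  forall A B, zariski_closure S A -> zariski_closure S B ->
    zariski_closure S (A *m B).
Proof.
move=> mulS A B clA clB.
have clSB A' : S A' -> zariski_closure S (A' *m B).
  move=> SA' Z clZ SZ; apply: (clB _ (closed_preimage (mulmx A') clZ)) => B' SB'.
  by apply/SZ/mulS.
move=> Z clZ SZ; apply: (clA _ (closed_preimage (mulmxr B) clZ)) => A' SA' /=.
exact: clSB.
Qed.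

Lemma line_polynomial A B (p : {mpoly K[n * n]}) :
  exists q : {poly K}, forall t, q.[t] = p.@[fun i => mxvec (A + t *: B) 0 i].
Proof.
exists (\sum_(m <- msupp p) p@_m *:
  \prod_i ((mxvec A 0 i)%:P + (mxvec B 0 i) *: 'X) ^+ m i) => t.
rewrite mevalE horner_sum; apply: eq_bigr => m _; rewrite hornerZ horner_prod.
congr (_ * _); apply: eq_bigr => i _.
by rewrite horner_exp hornerD hornerC hornerZ hornerX linearD linearZ !mxE mulrC.
Qed.

(** Restricted to the line, each defining polynomial is a polynomial in one
    variable that vanishes at all natural numbers. *)
Lemma closed_line A B Z : zariski_closed Z ->
  (forall k, Z (A + k%:R *: B)) -> forall t, Z (A + t *: B).
Proof.
move=> [P defZ] ZAB t; apply/defZ => p Pp.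
have [q qE] := line_polynomial A B p; rewrite -qE.
suff -> : q = 0 by rewrite horner0.
apply: (@roots_geq_poly_eq0 _ q [seq k%:R | k <- iota 0 (size q)]).
- by apply/allP=> _ /mapP[k _ ->]; apply/rootP; rewrite qE; apply: (defZ _).1.
- by rewrite map_inj_uniq ?iota_uniq //; apply: mulrIn; apply: oner_neq0.
- by rewrite size_map size_iota.
Qed.

End Zariski.

(** * Root elements and the stabilizer of a basis vector *)

Section Elementary.
Variable R : comNzRingType.
Implicit Types (a b c d t : R) (A B : 'M[R]_4).

Definition ve1 : 'cV[R]_4 := col4 1 0 0 0.
Definition ve2 : 'cV[R]_4 := col4 0 1 0 0.
Definition vf1 : 'cV[R]_4 := col4 0 0 1 0.
Definition vf2 : 'cV[R]_4 := col4 0 0 0 1.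

Inductive root_element t : 'M[R]_4 -> Prop :=
  | Root_e1 : root_element t (transv t ve1)
  | Root_e2 : root_element t (transv t ve2)
  | Root_f1 : root_element t (transv t vf1)
  | Root_f2 : root_element t (transv t vf2)
  | Root_e1e2 : root_element t (short t ve1 ve2)
  | Root_e1f2 : root_element t (short t ve1 vf2)
  | Root_e2f1 : root_element t (short t ve2 vf1)
  | Root_f1f2 : root_element t (short t vf1 vf2).

(** The matrix [(a, b; c, d)] acting on the plane spanned by [e1] and [f1],
    with [e2] and [f2] fixed. *)
Definition plane a b c d : 'M[R]_4 :=
  \matrix_(i, j) nth 0 (nth [::] [:: [:: a; 0; b; 0]; [:: 0; 1; 0; 0];
                                     [:: c; 0; d; 0]; [:: 0; 0; 0; 1]] i) j.

Section Action.
Variables x1 x2 y1 y2 : R.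

Lemma act_plane a b c d : plane a b c d *m col4 x1 x2 y1 y2 =
  col4 (a * x1 + b * y1) x2 (c * x1 + d * y1) y2.
Proof.
apply/matrixP=> i j; rewrite !mxE !big_ord_recl big_ord0 !mxE /=.
by case: i => [] [|[|[|[|//]]]] /= _; ring.
Qed.

Lemma act_e1 t : transv t ve1 *m col4 x1 x2 y1 y2 = col4 (x1 + t * y1) x2 y1 y2.
Proof. by rewrite transvE formE col4Z col4D; apply: eq_col4; ring. Qed.

Lemma act_e2 t : transv t ve2 *m col4 x1 x2 y1 y2 = col4 x1 (x2 + t * y2) y1 y2.
Proof. by rewrite transvE formE col4Z col4D; apply: eq_col4; ring. Qed.

Lemma act_f1 t : transv t vf1 *m col4 x1 x2 y1 y2 = col4 x1 x2 (y1 - t * x1) y2.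
Proof. by rewrite transvE formE col4Z col4D; apply: eq_col4; ring. Qed.

Lemma act_f2 t : transv t vf2 *m col4 x1 x2 y1 y2 = col4 x1 x2 y1 (y2 - t * x2).
Proof. by rewrite transvE formE col4Z col4D; apply: eq_col4; ring. Qed.

Lemma act_e1e2 t :
  short t ve1 ve2 *m col4 x1 x2 y1 y2 = col4 (x1 + t * y2) (x2 + t * y1) y1 y2.
Proof. by rewrite shortE !formE !col4Z !col4D; apply: eq_col4; ring. Qed.

Lemma act_f1f2 t :
  short t vf1 vf2 *m col4 x1 x2 y1 y2 = col4 x1 x2 (y1 - t * x2) (y2 - t * x1).
Proof. by rewrite shortE !formE !col4Z !col4D; apply: eq_col4; ring. Qed.

Lemma act_e2f1 t :
  short t ve2 vf1 *m col4 x1 x2 y1 y2 = col4 x1 (x2 - t * x1) (y1 + t * y2) y2.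
Proof. by rewrite shortE !formE !col4Z !col4D; apply: eq_col4; ring. Qed.

Lemma act_e1f2 t :
  short t ve1 vf2 *m col4 x1 x2 y1 y2 = col4 (x1 - t * x2) x2 y1 (y2 + t * y1).
Proof. by rewrite shortE !formE !col4Z !col4D; apply: eq_col4; ring. Qed.

End Action.

Definition actE := (act_plane, act_e1, act_e2, act_f1, act_f2,
  act_e1e2, act_f1f2, act_e2f1, act_e1f2).

Lemma fix_basis A : A *m ve1 = ve1 -> A *m ve2 = ve2 -> A *m vf1 = vf1 ->
  A *m vf2 = vf2 -> A = 1%:M.
Proof.
move=> Ae1 Ae2 Af1 Af2; apply: eq_mulcol => x; rewrite mul1mx.
have -> : x = x 0 0 *: ve1 + x 1 0 *: ve2 + x 2 0 *: vf1 + x 3 0 *: vf2.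
  by rewrite {1}(col4P x) !col4Z !col4D; apply: eq_col4; ring.
by rewrite !mulmxDr -!scalemxAr Ae1 Ae2 Af1 Af2.
Qed.

Lemma Sp4_root t A : root_element t A -> Sp4 A.
Proof.
have Sp4_short v w : spform v w = 0 -> Sp4 (short t v w).
  by move=> vw0; rewrite short_transv //; do !apply: Sp4_mul; apply: Sp4_transv.
by case; [exact: Sp4_transv|exact: Sp4_transv|exact: Sp4_transv|exact: Sp4_transv
  |apply: Sp4_short|apply: Sp4_short|apply: Sp4_short|apply: Sp4_short];
  rewrite formE; ring.
Qed.

Variables (I : R -> Prop) (C : 'M[R]_4 -> Prop).
Hypothesis addI : forall a b, I a -> I b -> I (a + b).
Hypothesis mulI : forall a b, I b -> I (a * b).
Hypothesis mulC : forall A B, C A -> C B -> C (A *m B).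
Hypothesis rootC : forall t A, I t -> root_element t A -> C A.

Let mulIr a b : I a -> I (a * b). Proof. by rewrite mulrC; apply: mulI. Qed.
Let oppI a : I a -> I (- a). Proof. by rewrite -mulN1r; apply: mulI. Qed.
Let subI a b : I a -> I b -> I (a - b).
Proof. by move=> Ia /oppI; apply: addI. Qed.

(** A symplectic matrix that fixes [e2] preserves its orthogonal space, hence
    acts on the quotient plane spanned by [e1] and [f1].  Once [planeC] makes
    this action unipotent, root elements with coefficients in the ideal [I]
    clear what is left, one root type at a time.  The ideal is that of a
    congruence subgroup in the integral case and the whole ring over a field. *)
Lemma stabilizer_fill A : Sp4 A -> (forall i j, I (A i j - (i == j)%:R)) ->
  (forall a c, I (a - 1) -> I c -> (exists b d, a * d - b * c = 1) ->
     exists al be ga de, [/\ C (plane al be ga de), Sp4 (plane al be ga de),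
                   I be, al * a + be * c = 1 & ga * a + de * c = 0]) ->
  A *m ve2 = ve2 -> exists2 B, C B & B *m A = 1%:M.
Proof.
move=> spA congA planeC Ae2.
have colA (x : 'cV[R]_4) : (x = ve1 \/ x = vf1 \/ x = vf2) ->
    exists x1 x2 y1 y2, [/\ A *m x = col4 x1 x2 y1 y2, I (x1 - x 0 0),
      I (x2 - x 1 0), I (y1 - x 2 0) & I (y2 - x 3 0)].
  move=> def_x; exists ((A *m x) 0 0), ((A *m x) 1 0), ((A *m x) 2 0), ((A *m x) 3 0).
  have congx j : (x = delta_mx j 0) -> forall i, I ((A *m x) i 0 - x i 0).
    by move=> -> i; rewrite -colE !mxE eqxx andbT.
  have [j /congx cx] : exists j, x = delta_mx j 0.
    case: def_x => [->|[->|->]]; [exists 0 | exists 2 | exists 3];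
      by apply/matrixP=> i j; rewrite !mxE !ord1; case: i => [] [|[|[|[|//]]]].
  by split; rewrite // -col4P.
have [|a [q [c [r [Ae1]]]]] := colA ve1; first by left.
rewrite !mxE /= !subr0 => Ia Iq Ic _.
have [|b [q' [d [r' [Af1]]]]] := colA vf1; first by right; left.
rewrite !mxE /= !subr0 => Ib Iq' _ _.
have [|b1 [b2 [b3 [b4 [Af2]]]]] := colA vf2; first by right; right.
rewrite !mxE /= !subr0 => _ Ib2 _ _ {colA}.
(* The form with [e2 = A e2] kills the [f2] coordinates of the images of [e1]
   and [f1]. *)
have r0 : r = 0.
  by have := Sp4_form ve2 ve1 spA; rewrite Ae1 Ae2 !formE => eq0;
    refine (etrans (etrans _ eq0) _); ring.
have r'0 : r' = 0.
  by have := Sp4_form ve2 vf1 spA; rewrite Af1 Ae2 !formE => eq0;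
    refine (etrans (etrans _ eq0) _); ring.
have det1 : a * d - b * c = 1.
  by have := Sp4_form ve1 vf1 spA; rewrite Ae1 Af1 !formE r0 r'0 => eq1;
    refine (etrans (etrans _ eq1) _); ring.
have [al [be [ga [de [Cg spg Ibe ala gaa]]]]] : exists al be ga de,
    [/\ C (plane al be ga de), Sp4 (plane al be ga de),
        I be, al * a + be * c = 1 & ga * a + de * c = 0].
  by apply: planeC => //; exists b, d.
(* After the plane matrix, [p] is the remaining [e1] coordinate of the image of
   [f1]; [q] and [q2] are the [e2] coordinates of the images of [e1] and [f1],
   the latter once [p] is cleared. *)
pose p := al * b + be * d; pose q2 := q' - q * p.
have Ip : I p by apply: addI; [apply: mulI | apply: mulIr].
have Iq2 : I q2 by apply: subI => //; apply: mulI.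
pose g := short (- q2) ve1 ve2 *m (transv (- p) ve1 *m
            (short q ve2 vf1 *m plane al be ga de)).
have root_spC t B : I t -> root_element t B -> C B /\ Sp4 B.
  by move=> It rB; split; [apply: rootC rB | apply: Sp4_root rB].
have [C1 sp1] := root_spC q _ Iq (Root_e2f1 q).
have [C2 sp2] := root_spC (- p) _ (oppI Ip) (Root_e1 _).
have [C3 sp3] := root_spC (- q2) _ (oppI Iq2) (Root_e1e2 _).
have Cgg : C g by do !apply: mulC.
have spgA : Sp4 (g *m A) by do !apply: Sp4_mul.
have gAe2 : g *m A *m ve2 = ve2.
  by rewrite -mulmxA Ae2 -!mulmxA !actE; apply: eq_col4; ring.
have gAe1 : g *m A *m ve1 = ve1.
  rewrite -mulmxA Ae1 -!mulmxA !actE ala gaa r0; apply: eq_col4; ring.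
have s1 : ga * b + de * d = 1.
  have := Sp4_form ve1 vf1 (Sp4_mul spg spA).
  by rewrite -!mulmxA Ae1 Af1 !actE ala gaa r0 r'0 !formE => eq1;
    refine (etrans (etrans _ eq1) _); ring.
have gAf1 : g *m A *m vf1 = vf1.
  rewrite -mulmxA Af1 -!mulmxA !actE s1 -/p r'0; apply: eq_col4; rewrite /q2; ring.
have [s' Is' gAf2] : exists2 s, I s & g *m A *m vf2 = col4 0 s 0 1.
  have [x1 [x2 [y1 [y2 [gAf2 Ix2]]]]] : exists x1 x2 y1 y2,
      g *m A *m vf2 = col4 x1 x2 y1 y2 /\ I x2.
    rewrite -mulmxA Af2 -!mulmxA !actE; do 4!eexists; split; first by [].
    by do ?[apply: addI | apply: subI | apply: oppI]; do ?[done | apply: mulIr | apply: oppI].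
  have := Sp4_form ve1 vf2 spgA; have := Sp4_form ve2 vf2 spgA.
  have := Sp4_form vf1 vf2 spgA; rewrite gAe1 gAe2 gAf1 gAf2 !formE => eq1 eq2 eq3.
  exists x2 => //; apply: eq_col4 => //;
    [refine (etrans (etrans (esym (opprK _)) (congr1 -%R (etrans _ eq1))) _)
    | refine (etrans (etrans _ eq3) _) | refine (etrans (etrans _ eq2) _)]; ring.
have [C4 sp4] := root_spC (- s') _ (oppI Is') (Root_e2 _).
exists (transv (- s') ve2 *m g); first exact: mulC.
by rewrite -mulmxA; apply: fix_basis; rewrite -mulmxA ?gAe1 ?gAe2 ?gAf1 ?gAf2 !actE;
  apply: eq_col4; ring.
Qed.

End Elementary.

(** * Generation of the symplectic group over a field *)

Section Planes.
Variable R : comNzRingType.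
Implicit Types (a b c d t : R).

Lemma planeM a b c d a' b' c' d' :
  plane a b c d *m plane a' b' c' d' =
  plane (a * a' + b * c') (a * b' + b * d') (c * a' + d * c') (c * b' + d * d').
Proof.
apply: eq_mulcol => x; rewrite (col4P x) -mulmxA !act_plane.
by apply: eq_col4; ring.
Qed.

Lemma plane_e1 t : plane 1 t 0 1 = transv t (ve1 R).
Proof.
by apply: eq_mulcol => x; rewrite (col4P x) actE act_e1; apply: eq_col4; ring.
Qed.

Lemma plane_f1 t : plane 1 0 (- t) 1 = transv t (vf1 R).
Proof.
by apply: eq_mulcol => x; rewrite (col4P x) actE act_f1; apply: eq_col4; ring.
Qed.

Lemma Sp4_plane a b c d : a * d - b * c = 1 -> Sp4 (plane a b c d).
Proof.
move=> det1; apply: Sp4P => v w; rewrite (col4P v) (col4P w) !act_plane !formE.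
move: (v 0 0) (v 1 0) (v 2 0) (v 3 0) (w 0 0) (w 1 0) (w 2 0) (w 3 0).
move=> x1 x2 y1 y2 x1' x2' y1' y2'.
transitivity ((a * d - b * c) * (x1 * y1' - y1 * x1') + x2 * y2' - y2 * x2').
  by ring.
by rewrite det1; ring.
Qed.
End Planes.

Section FieldPlane.
Variables (F : fieldType) (C : 'M[F]_4 -> Prop).
Hypothesis mulC : forall A B, C A -> C B -> C (A *m B).
Hypothesis e1C : forall t, C (transv t (ve1 F)).
Hypothesis f1C : forall t, C (transv t (vf1 F)).

(** Transvections along [e1] and [f1] generate the special linear group of the
    plane, which is transitive on nonzero vectors. *)
Lemma field_plane (a c : F) : a != 0 \/ c != 0 ->
  exists al be ga de, [/\ C (plane al be ga de),
                   al * a + be * c = 1 & ga * a + de * c = 0].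
Proof.
have planeC al be ga de : C (plane al be ga de) ->
    al * a + be * c = 1 -> ga * a + de * c = 0 ->
  exists al be ga de, [/\ C (plane al be ga de),
                   al * a + be * c = 1 & ga * a + de * c = 0].
  by move=> *; exists al, be, ga, de; split.
have [c0 [|//] a_n0|c_n0 _] := eqVneq c 0.
  have : C (transv a (vf1 F) *m transv ((1 - a) / a) (ve1 F) *m
            transv (-1) (vf1 F)) by do !apply: mulC.
  by rewrite -plane_e1 -!plane_f1 !planeM => /planeC; apply; rewrite c0; field.
have : C (transv c (vf1 F) *m transv ((1 - a) / c) (ve1 F)) by do !apply: mulC.
by rewrite -plane_e1 -!plane_f1 !planeM => /planeC; apply; field.
Qed.
End FieldPlane.

Section FieldFill.
Variables (F : fieldType) (C : 'M[F]_4 -> Prop).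
Hypothesis mulC : forall A B, C A -> C B -> C (A *m B).
Hypothesis spC : forall A, C A -> Sp4 A.
Hypothesis rootC : forall t A, root_element t A -> C A.

(** It is enough to treat a vector with nonzero [e2] coordinate: the others
    become so after one root element. *)
Lemma field_reach (x1 x2 y1 y2 : F) : ~~ [&& x1 == 0, x2 == 0, y1 == 0 & y2 == 0] ->
  exists2 B, C B & B *m col4 x1 x2 y1 y2 = ve2 F.
Proof.
pose reach x := exists2 B, C B & B *m x = ve2 F.
have step B x : C B -> reach (B *m x) -> reach x.
  by move=> CB [B' CB' B'x]; exists (B' *m B); [apply: mulC | rewrite -mulmxA].
have x2_reach a b c d : b != 0 -> reach (col4 a b c d).
  move=> b_n0; apply: (step _ _ (rootC (Root_e1f2 ((a - 1) / b)))); rewrite act_e1f2.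
  rewrite (_ : a - _ = 1); last by field.
  move: (d + _) => {}d.
  apply: (step _ _ (rootC (Root_e2f1 (b - 1)))); rewrite act_e2f1.
  rewrite (_ : b - _ = 1); last by ring.
  move: (c + _) => {}c.
  apply: (step _ _ (rootC (Root_f1f2 c))); rewrite act_f1f2.
  rewrite (_ : c - _ = 0); last by ring.
  move: (d - _) => {}d.
  apply: (step _ _ (rootC (Root_f2 d))); rewrite act_f2.
  apply: (step _ _ (rootC (Root_e1f2 1))); rewrite act_e1f2.
  by exists 1%:M; [rewrite -(transv0 (ve1 F)); apply: rootC (Root_e1 0) |
    rewrite mul1mx; apply: eq_col4; ring].
have [-> |] := eqVneq x2 0; last by move=> ? _; apply: x2_reach.
have [-> |] := eqVneq y2 0.
  have [-> |] := eqVneq x1 0.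
    rewrite /= andbT => y1_n0.
    apply: (step _ _ (rootC (Root_e1e2 1))); rewrite act_e1e2; apply: x2_reach.
    by rewrite add0r mul1r.
  move=> x1_n0 _; apply: (step _ _ (rootC (Root_e2f1 1))); rewrite act_e2f1.
  by apply: x2_reach; rewrite sub0r mul1r oppr_eq0.
move=> y2_n0 _; apply: (step _ _ (rootC (Root_e2 1))); rewrite act_e2.
by apply: x2_reach; rewrite add0r mul1r.
Qed.

(** Gaussian elimination: a column is brought to [e2], and the stabilizer of
    [e2] is treated by [stabilizer_fill] with the whole field as ideal. *)
Lemma field_fill A : Sp4 A -> exists2 B, C B & B *m A = 1%:M.
Proof.
move=> spA.
have [B CB BAe2] : exists2 B, C B & B *m (A *m ve2 F) = ve2 F.
  rewrite (col4P (A *m _)); apply: field_reach; apply/negP => /and4P[].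
  move=> /eqP a0 /eqP b0 /eqP c0 /eqP d0.
  have := Sp4_form (ve2 F) (vf2 F) spA.
  rewrite (col4P (A *m ve2 F)) a0 b0 c0 d0 (col4P (A *m vf2 F)) !formE.
  move/(congr1 -%R)/eqP; rewrite -subr_eq0 => /eqP eq1.
  have /eqP := oner_neq0 F; case; apply: etrans (etrans _ eq1) _; ring.
rewrite mulmxA in BAe2.
have [] := @stabilizer_fill F (fun=> True) C _ _ mulC _ (B *m A) => //.
- by move=> t D _; apply: rootC.
- by apply: Sp4_mul => //; apply: spC.
- move=> a c _ _ [b [d det1]].
  have [t|t||al [be [ga [de [CP eq1 eq0]]]]] := @field_plane F C mulC _ _ a c.
  - exact: rootC (Root_e1 t).
  - exact: rootC (Root_f1 t).
  - apply/orP; rewrite -negb_and; apply/negP => /andP[/eqP a0 /eqP c0].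
    by move/eqP: det1; rewrite a0 c0 mul0r mulr0 subr0 eq_sym oner_eq0.
  by exists al, be, ga, de; split=> //; apply: spC.
by move=> D CD; rewrite mulmxA => DBA1; exists (D *m B) => //; apply: mulC.
Qed.
End FieldFill.

(** * Density from four transvections *)

Section Maps.
Variables (R S : comNzRingType) (f : {rmorphism R -> S}).

Lemma map_Omega : map_mx f (Omega R) = Omega S.
Proof.
apply/matrixP=> i j; rewrite /Omega !mxE.
by case: splitP => ? _; rewrite !mxE; case: splitP => ? _; rewrite !mxE ?rmorphN
  ?rmorph_nat ?rmorph0.
Qed.

Lemma map_transv a v : map_mx f (transv a v) = transv (f a) (map_mx f v).
Proof.
by rewrite /transv map_mxD map_mx1 map_mxZ !map_mxM /= map_trmx map_Omega.
Qed.

Lemma map_col4 (a b c d : R) : map_mx f (col4 a b c d) = col4 (f a) (f b) (f c) (f d).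
Proof.
by apply/matrixP=> i j; rewrite !mxE; case: i => [] [|[|[|[|//]]]].
Qed.

Lemma map_adjsp A : map_mx f (adjsp A) = adjsp (map_mx f A).
Proof. by rewrite /adjsp map_mxN !map_mxM /= map_Omega map_trmx. Qed.

Lemma map_Sp4 A : Sp4 A -> Sp4 (map_mx f A).
Proof.
rewrite /Sp4 => /(congr1 (map_mx f)).
by rewrite !map_mxM /= map_Omega map_trmx.
Qed.

End Maps.

Lemma adjsp_unique (R : comNzRingType) (A B : 'M[R]_4) :
  Sp4 A -> A *m B = 1%:M -> B = adjsp A.
Proof. by move=> spA AB; rewrite -[B]mul1mx -(adjspK spA) -mulmxA AB mulmx1. Qed.

Lemma adjspM (R : comNzRingType) (A B : 'M[R]_4) : Sp4 A -> Sp4 B ->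
  adjsp (A *m B) = adjsp B *m adjsp A.
Proof.
move=> spA spB; apply/esym/adjsp_unique; first exact: Sp4_mul.
by rewrite mulmxA -(mulmxA A) adjspKr // mulmx1 adjspKr.
Qed.

Lemma adjsp_transv (R : comNzRingType) (a : R) v : adjsp (transv a v) = transv (- a) v.
Proof.
apply/esym/adjsp_unique; first exact: Sp4_transv.
by rewrite transvD subrr transv0.
Qed.

Lemma adjsp_inv (R : comNzRingType) (A : 'M[R]_4) : Sp4 A -> adjsp (adjsp A) = A.
Proof.
by move=> spA; apply/esym/adjsp_unique; [apply: Sp4_adjsp | apply: adjspK].
Qed.

(** The set [D] of directions whose transvections all lie in the closure is
    stable under the closure.  The hypotheses on [(a, b)] and [(c, d)] let the
    plane [e1, f1] move the last two directions to [e1 + e2] and [e1 + f2];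
    their transvections move each other, which gives [e2 + f2], [e2 - f2], then
    [e2] and [f2], and sums of orthogonal directions give the short roots. *)
Lemma transv_density (G : 'M[rat]_4 -> Prop) (k1 k2 k3 k4 a b c d : rat) :
  (forall A, G A -> Sp4 A) -> G 1%:M -> (forall A B, G A -> G B -> G (A *m B)) ->
  k1 != 0 -> k2 != 0 -> k3 != 0 -> k4 != 0 ->
  a != 0 \/ b != 0 -> c != 0 \/ d != 0 ->
  G (transv k1 (ve1 rat)) -> G (transv k2 (vf1 rat)) ->
  G (transv k3 (col4 a 1 b 0)) -> G (transv k4 (col4 c 0 d 1)) ->
  zariski_dense_in_Sp4 G.
Proof.
move=> spG G1 mulG k1n0 k2n0 k3n0 k4n0 abn0 cdn0 Ge1 Gf1 Gu Gw.
pose S (B : 'M[algC]_4) := exists2 A, G A & B = map_mx ratr A.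
have spS A : S A -> Sp4 A by case=> B /spG spB ->; apply: map_Sp4.
split=> // Z clZ SZ A spA; suff: zariski_closure S A by apply.
(* The inverse is recorded along with the matrix, as [D_mul] conjugates by it. *)
pose C B := [/\ Sp4 B, zariski_closure S B & zariski_closure S (adjsp B)].
have mulS B B' : S B -> S B' -> S (B *m B').
  case=> [D GD ->] [D' GD' ->]; exists (D *m D'); first exact: mulG.
  by rewrite map_mxM.
have mulC B B' : C B -> C B' -> C (B *m B').
  case=> [spB clB clB'] [spD clD clD']; split; first exact: Sp4_mul.
    exact: closure_mul.
  by rewrite adjspM //; apply: closure_mul.
have spC B : C B -> Sp4 B by case.
have adjC B : C B -> C (adjsp B).
  by case=> spB clB clB'; split; rewrite ?adjsp_inv //; apply: Sp4_adjsp.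
pose D v := forall t, C (transv t v).
have transvD_cl k v : k != 0 -> G (transv k v) -> D (map_mx ratr v).
  move=> kn0 Gkv t.
  have cl_t s : zariski_closure S (transv s (map_mx ratr v)).
    move=> Z' clZ' SZ'.
    have -> : s = s / ratr k * ratr k by rewrite divfK // fmorph_eq0.
    rewrite /transv -scalerA; apply: closed_line => // n.
    rewrite scalerA -/(transv _ _); apply: SZ'.
    exists (transv (n%:R * k) v); last by rewrite map_transv rmorphM rmorph_nat.
    elim: n => [|n IHn]; first by rewrite mul0r transv0.
    by rewrite -addn1 natrD mulrDl mul1r -transvD; apply: mulG.
  by split; rewrite ?adjsp_transv //; apply: Sp4_transv.
have D_mul B v : C B -> D v -> D (B *m v).
  move=> CB Dv t; have -> : transv t (B *m v) = B *m transv t v *m adjsp B.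
    have spB := spC _ CB.
    by rewrite transv_conj // -mulmxA adjspKr // mulmx1.
  exact: mulC _ _ (mulC _ _ CB (Dv t)) (adjC _ CB).
have D_scale k v : k != 0 -> D (k *: v) -> D v.
  move=> kn0 Dkv t; have -> : t = t / k ^+ 2 * k ^+ 2 by rewrite divfK ?expf_neq0.
  by rewrite -transvZ.
have De1 : D (ve1 algC).
  have := transvD_cl _ _ k1n0 Ge1; rewrite map_col4 !rmorph0 rmorph1; exact.
have Df1 : D (vf1 algC).
  have := transvD_cl _ _ k2n0 Gf1; rewrite map_col4 !rmorph0 rmorph1; exact.
have {}Gu := transvD_cl _ _ k3n0 Gu; rewrite map_col4 rmorph0 rmorph1 in Gu.
have {}Gw := transvD_cl _ _ k4n0 Gw; rewrite map_col4 rmorph0 rmorph1 in Gw.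
have ratr_n0 x y : x != 0 \/ y != 0 -> (ratr x : algC) != 0 \/ (ratr y : algC) != 0.
  by rewrite !fmorph_eq0.
have D1100 : D (col4 1 1 0 0).
  have [al [be [ga [de [CP eq1 eq0]]]]] := field_plane mulC De1 Df1 (ratr_n0 _ _ abn0).
  by have := D_mul _ _ CP Gu; rewrite act_plane eq1 eq0.
have D1001 : D (col4 1 0 0 1).
  have [al [be [ga [de [CP eq1 eq0]]]]] := field_plane mulC De1 Df1 (ratr_n0 _ _ cdn0).
  by have := D_mul _ _ CP Gw; rewrite act_plane eq1 eq0.
have CW : C (plane 0 1 (-1) 0).
  have -> : plane 0 1 (-1) 0 = transv 1 (ve1 algC) *m transv 1 (vf1 algC) *m transv 1 (ve1 algC).
    by rewrite -!plane_e1 -plane_f1 !planeM; congr plane; ring.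
  exact: mulC _ _ (mulC _ _ (De1 1) (Df1 1)) (De1 1).
have DW x1 x2 y1 y2 : D (col4 x1 x2 y1 y2) -> D (col4 y1 x2 (- x1) y2).
  move/(D_mul _ _ CW); rewrite act_plane; congr D; apply: eq_col4; ring.
have D_lin v w k s : k * spform w v = s -> D w -> D v -> D (v + s *: w).
  by move=> kwv Dw Dv; have := D_mul _ _ (Dw k) Dv; rewrite transvE kwv.
have D0110 : D (col4 0 1 1 0).
  by have := DW _ _ _ _ (DW _ _ _ _ (DW _ _ _ _ D1100)); rewrite !oppr0 opprK.
have D0011 : D (col4 0 0 1 1).
  by have := DW _ _ _ _ (DW _ _ _ _ (DW _ _ _ _ D1001)); rewrite !oppr0 opprK.
have Dm1100 : D (col4 (-1) 1 0 0).
  by have := DW _ _ _ _ (DW _ _ _ _ D1100); rewrite oppr0.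
have D0101 : D (col4 0 1 0 1).
  have -> : col4 0 1 0 1 = col4 (-1) 1 0 0 + 1 *: col4 1 0 0 1 :> 'cV[algC]_4.
    by rewrite col4Z col4D; apply: eq_col4; ring.
  by apply: (D_lin _ _ (-1) 1 _ D1001 Dm1100); rewrite formE; ring.
have D010m1 : D (col4 0 1 0 (-1)).
  have -> : col4 0 1 0 (-1) = col4 1 1 0 0 + -1 *: col4 1 0 0 1 :> 'cV[algC]_4.
    by rewrite col4Z col4D; apply: eq_col4; ring.
  by apply: (D_lin _ _ 1 (-1) _ D1001 D1100); rewrite formE; ring.
have De2 : D (ve2 algC).
  apply: (D_scale 2%:R); first by rewrite pnatr_eq0.
  have -> : 2%:R *: ve2 algC = col4 0 1 0 1 + 1 *: col4 0 1 0 (-1).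
    by rewrite !col4Z col4D; apply: eq_col4; ring.
  by apply: (D_lin _ _ (2%:R^-1) 1 _ D010m1 D0101); rewrite formE; field.
have Df2 : D (vf2 algC).
  apply: (D_scale 2%:R); first by rewrite pnatr_eq0.
  have -> : 2%:R *: vf2 algC = col4 0 1 0 1 + -1 *: col4 0 1 0 (-1).
    by rewrite !col4Z col4D; apply: eq_col4; ring.
  by apply: (D_lin _ _ (- 2%:R^-1) (-1) _ D010m1 D0101); rewrite formE; field.
have Dshort v w t : spform v w = 0 -> D v -> D w -> D (v + w) -> C (short t v w).
  move=> vw0 Dv Dw Dvw; rewrite short_transv //.
  exact: mulC _ _ (mulC _ _ (Dvw t) (Dv (- t))) (Dw (- t)).
have short0 v w u t : D v -> D w -> D u -> spform v w = 0 -> v + w = u -> C (short t v w).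
  by move=> Dv Dw Du vw0 vwu; rewrite -vwu in Du; exact (Dshort _ _ t vw0 Dv Dw Du).
have rootC t B : root_element t B -> C B.
  case.
  - exact (De1 t).
  - exact (De2 t).
  - exact (Df1 t).
  - exact (Df2 t).
  - refine (short0 _ _ _ t De1 De2 D1100 _ _); first by rewrite formE; ring.
    by rewrite col4D; apply: eq_col4; ring.
  - refine (short0 _ _ _ t De1 Df2 D1001 _ _); first by rewrite formE; ring.
    by rewrite col4D; apply: eq_col4; ring.
  - refine (short0 _ _ _ t De2 Df1 D0110 _ _); first by rewrite formE; ring.
    by rewrite col4D; apply: eq_col4; ring.
  - refine (short0 _ _ _ t Df1 Df2 D0011 _ _); first by rewrite formE; ring.
    by rewrite col4D; apply: eq_col4; ring.
have [B [spB clB clB'] BA1] := field_fill mulC spC rootC spA.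
by rewrite (adjsp_unique spB BA1).
Qed.

(** * Computable rational matrices *)

(** Binary recursion, so that numerals unfold to terms of logarithmic size that
    decision procedures on rationals accept. *)
Fixpoint rat_of_pos (p : positive) : rat :=
  match p with
  | xH => 1
  | xO q => 2%:R * rat_of_pos q
  | xI q => 1 + 2%:R * rat_of_pos q
  end.

Definition rat_of_Z (z : Z) : rat :=
  match z with
  | Z0 => 0
  | Zpos p => rat_of_pos p
  | Zneg p => - rat_of_pos p
  end.

Lemma rat_of_ZE z : rat_of_Z z = (int_of_Z z)%:~R.
Proof.
have posE p : rat_of_pos p = (Pos.to_nat p)%:R.
  elim: p => [p IH|p IH|//] /=; rewrite IH ?Pos2Nat.inj_xI ?Pos2Nat.inj_xO.
    by rewrite -natrM nat1r.
  by rewrite -natrM.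
case: z => [|p|p] //=; rewrite posE //.
by rewrite NegzE prednK ?mulrNz //; apply/ssrnat.ltP/Pos2Nat.is_pos.
Qed.

Lemma rat_of_ZM x y : rat_of_Z (x * y)%coqZ = rat_of_Z x * rat_of_Z y.
Proof. by rewrite !rat_of_ZE -intrM -rmorphM. Qed.

Lemma rat_of_ZD x y : rat_of_Z (x + y)%coqZ = rat_of_Z x + rat_of_Z y.
Proof. by rewrite !rat_of_ZE -intrD -rmorphD. Qed.

Lemma rat_of_ZN x : rat_of_Z (- x)%coqZ = - rat_of_Z x.
Proof. by rewrite !rat_of_ZE -intrN -rmorphN. Qed.

Lemma rat_of_Z_eq0 x : (rat_of_Z x == 0) = (x =? 0)%coqZ.
Proof.
rewrite rat_of_ZE intr_eq0; apply/eqP/Z.eqb_spec => [|-> //].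
by move/(congr1 Z_of_int); rewrite int_of_ZK.
Qed.

Definition zmx := seq (seq Z).
Definition zget (M : zmx) i j : Z := nth 0%coqZ (nth [::] M i) j.
Definition ztab (f : nat -> nat -> Z) : zmx :=
  [seq [seq f i j | j <- iota 0 4] | i <- iota 0 4].

Lemma zget_tab f i j : (i < 4)%N -> (j < 4)%N -> zget (ztab f) i j = f i j.
Proof. by case: i => [|[|[|[|i]]]] //; case: j => [|[|[|[|j]]]]. Qed.

(** A common denominator and the integral numerators; the pair is not reduced,
    and equality is tested by cross-multiplication. *)
Definition qmx := (Z * zmx)%type.

Definition mx_of (A : qmx) : 'M[rat]_4 :=
  (rat_of_Z A.1)^-1 *: \matrix_(i < 4, j < 4) rat_of_Z (zget A.2 i j).

Definition qmul (A B : qmx) : qmx :=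
  ((A.1 * B.1)%coqZ, ztab (fun i j => zget A.2 i 0 * zget B.2 0 j +
     (zget A.2 i 1 * zget B.2 1 j + (zget A.2 i 2 * zget B.2 2 j +
      zget A.2 i 3 * zget B.2 3 j)))%coqZ).

Lemma mx_of_mul A B : mx_of (qmul A B) = mx_of A *m mx_of B.
Proof.
case: A B => [a A] [b B]; rewrite /mx_of -scalemxAl -scalemxAr scalerA /=.
rewrite rat_of_ZM invfM; congr (_ *: _); apply/matrixP=> i j; rewrite !mxE.
rewrite zget_tab //= !rat_of_ZD !rat_of_ZM.
by rewrite !big_ord_recl big_ord0 !mxE addr0.
Qed.

Definition qadj (A : qmx) : qmx :=
  (A.1, ztab (fun i j => let a := zget A.2 ((j + 2) %% 4) ((i + 2) %% 4) in
     if (i < 2)%N == (j < 2)%N then a else (- a)%coqZ)).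

Lemma Omega_entries (R : comNzRingType) : Omega R = \matrix_(i < 4, j < 4)
  (nth 0%:Z (nth [::] [:: [:: 0; 0; 1; 0]; [:: 0; 0; 0; 1]; [:: -1; 0; 0; 0];
                          [:: 0; -1; 0; 0]] i) j)%:~R.
Proof.
apply: eq_mulcol => x; rewrite (col4P x) Omega_col4.
apply/matrixP=> i j; rewrite !mxE !big_ord_recl big_ord0 !mxE /=.
by case: i => [] [|[|[|[|//]]]] /= _; ring.
Qed.

Lemma mx_of_adj A : mx_of (qadj A) = adjsp (mx_of A).
Proof.
case: A => [a A]; rewrite /mx_of /adjsp linearZ -scalemxAr -scalemxAl -scalerN /=.
congr (_ *: _); rewrite Omega_entries.
apply/matrixP=> i j; rewrite !mxE zget_tab //.
rewrite !big_ord_recl big_ord0 !mxE !big_ord_recl !big_ord0 !mxE /=.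
by case: i j => [] [|[|[|[|//]]]] ? [] [|[|[|[|//]]]] ? /=;
  rewrite ?rat_of_ZN; ring.
Qed.

Definition qeq (A B : qmx) : bool :=
  [&& ~~ (A.1 =? 0)%coqZ, ~~ (B.1 =? 0)%coqZ &
   all (fun i => all (fun j =>
     (B.1 * zget A.2 i j =? A.1 * zget B.2 i j)%coqZ) (iota 0 4)) (iota 0 4)].

Lemma qeqP A B : qeq A B -> mx_of A = mx_of B.
Proof.
case: A B => [a A] [b B] /and3P[]; rewrite -!rat_of_Z_eq0 => a0 b0 /allP eqAB.
apply/matrixP=> i j; rewrite !mxE /=.
have iI : (i : nat) \in iota 0 4 by rewrite mem_iota ltn_ord.
have jI : (j : nat) \in iota 0 4 by rewrite mem_iota ltn_ord.
have /allP/(_ (j : nat) jI)/Z.eqb_spec/(congr1 rat_of_Z) := eqAB (i : nat) iI.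
rewrite !rat_of_ZM => {}eqAB; apply: (mulfI a0); rewrite mulVKf //.
by apply: (mulfI b0); rewrite eqAB [X in _ = _ * X]mulrCA mulVKf.
Qed.

Definition qid : qmx := (1%coqZ, ztab (fun i j => if i == j then 1%coqZ else 0%coqZ)).

Lemma mx_of_id : mx_of qid = 1%:M.
Proof.
rewrite /mx_of invr1 scale1r; apply/matrixP=> i j; rewrite !mxE zget_tab //.
by rewrite -val_eqE; case: eqP.
Qed.

Lemma trmx_col4_Omega (R : comNzRingType) (x1 x2 y1 y2 : R) :
  (col4 x1 x2 y1 y2)^T *m Omega R = \row_j nth 0 [:: - y1; - y2; x1; x2] j.
Proof.
rewrite Omega_entries; apply/matrixP=> i j.
rewrite !mxE !big_ord_recl big_ord0 !mxE /=.
by case: j => [] [|[|[|[|//]]]] ? /=; ring.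
Qed.

(** The transvection with coefficient [kn / kd] along the vector
    [(x1, x2, y1, y2) / s]. *)
Definition qtransv (kn kd x1 x2 y1 y2 s : Z) : qmx :=
  let v := [:: x1; x2; y1; y2] in let w := [:: (- y1)%coqZ; (- y2)%coqZ; x1; x2] in
  let d := (kd * (s * s))%coqZ in
  (d, ztab (fun i j => (if i == j then d else 0) +
                       kn * (nth 0 v i * nth 0 w j))%coqZ).

Lemma mx_of_transv kn kd x1 x2 y1 y2 s : ~~ (kd =? 0)%coqZ -> ~~ (s =? 0)%coqZ ->
  mx_of (qtransv kn kd x1 x2 y1 y2 s) =
  transv (rat_of_Z kn / rat_of_Z kd)
    (col4 (rat_of_Z x1 / rat_of_Z s) (rat_of_Z x2 / rat_of_Z s)
          (rat_of_Z y1 / rat_of_Z s) (rat_of_Z y2 / rat_of_Z s)).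
Proof.
rewrite -!rat_of_Z_eq0 => kd0 s0; set k := rat_of_Z kn / _.
set d := rat_of_Z kd * rat_of_Z s ^+ 2.
have d0 : d != 0 by rewrite mulf_neq0 ?expf_neq0.
have dE : rat_of_Z (kd * (s * s))%coqZ = d by rewrite !rat_of_ZM -expr2.
rewrite /transv trmx_col4_Omega; apply/matrixP=> i j.
rewrite /mx_of !mxE big_ord1 !mxE zget_tab // rat_of_ZD [_.1]/= dE mulrDr.
rewrite -val_eqE /=; congr (_ + _).
  by case: eqP => _; rewrite ?dE ?mulVf ?mulr0.
rewrite !rat_of_ZM /d /k; case: i j => [] [|[|[|[|//]]]] ? [] [|[|[|[|//]]]] ? /=;
  rewrite ?rat_of_ZN; field; by rewrite s0 kd0.
Qed.

(** * Words in the generators and certificates *)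

(** Closure under [adjsp] is closure under inverses, in a form that computes. *)
Definition symplectic_group (G : 'M[rat]_4 -> Prop) : Prop :=
  [/\ forall A, G A -> Sp4 A, G 1%:M, forall A B, G A -> G B -> G (A *m B)
    & forall A, G A -> G (adjsp A)].

(** Letters are pairs of an index in a list of matrices and an exponent. *)
Definition word := seq (nat * Z).

Definition qpow (A : qmx) (e : Z) : qmx :=
  match e with
  | Z0 => qid
  | Zpos p => Pos.iter (qmul A) qid p
  | Zneg p => Pos.iter (qmul (qadj A)) qid p
  end.

Definition eval_word (s : seq qmx) (w : word) : qmx :=
  foldr (fun l B => qmul (qpow (nth qid s l.1) l.2) B) qid w.

(** A straight-line program: each line is a word in the given matrices and the
    results of the previous lines.  It keeps certificates short when the words
    in the generators alone would be very long. *)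
Definition run (s : seq qmx) (p : seq word) : seq qmx :=
  foldl (fun s w => rcons s (eval_word s w)) s p.

Section Words.
Variable G : 'M[rat]_4 -> Prop.
Hypothesis groupG : symplectic_group G.

Definition all_in (s : seq qmx) : Prop := forall i, G (mx_of (nth qid s i)).

Lemma qpow_in A e : G (mx_of A) -> G (mx_of (qpow A e)).
Proof.
have [_ G1 mulG adjG] := groupG; move=> GA.
have iterG B p : G (mx_of B) -> G (mx_of (Pos.iter (qmul B) qid p)).
  move=> GB; apply: (Pos.iter_invariant p _ _ (fun X => G (mx_of X))).
    by move=> X GX; rewrite mx_of_mul; apply: mulG.
  by rewrite mx_of_id.
case: e => [|p|p] /=; [by rewrite mx_of_id | exact: iterG |].
by apply: iterG; rewrite mx_of_adj; apply: adjG.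
Qed.

Lemma eval_word_in s w : all_in s -> G (mx_of (eval_word s w)).
Proof.
have [_ G1 mulG _] := groupG; move=> Gs; elim: w => [|l w IHw] /=.
  by rewrite mx_of_id.
by rewrite mx_of_mul; apply: mulG => //; apply: qpow_in.
Qed.

Lemma run_in s p : all_in s -> all_in (run s p).
Proof.
elim: p s => //= w p IHp s Gs; apply: IHp => i; rewrite nth_rcons.
have [_ G1 _ _] := groupG.
by case: ltnP => _; [apply: Gs | case: eqP => _; [apply: eval_word_in | rewrite mx_of_id]].
Qed.
End Words.

Definition qconj (P Pi A : qmx) : qmx := qmul Pi (qmul A P).

(** In the basis given by the columns of [P], with inverse [Pi], all members of
    [s] become symplectic. *)
Definition frame_check (P Pi : qmx) (s : seq qmx) : bool :=
  qeq (qmul P Pi) qid &&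
  all (fun A => let B := qconj P Pi A in qeq (qmul (qadj B) B) qid) s.

Lemma adjsp_Sp4 (R : comNzRingType) (A : 'M[R]_4) : adjsp A *m A = 1%:M -> Sp4 A.
Proof.
move=> /(congr1 (mulmx (Omega R))).
by rewrite mulmx1 /adjsp mulNmx mulmxN !mulmxA Omega2 !mulNmx mul1mx opprK.
Qed.

Section Frame.
Variables (P Pi : qmx) (s : seq qmx).
Hypothesis checked : frame_check P Pi s.
Let T := mx_of P.
Let gens := [seq mx_of A | A <- s].

Lemma frame_mulr : T *m mx_of Pi = 1%:M.
Proof. by have /andP[/qeqP] := checked; rewrite mx_of_mul mx_of_id. Qed.

Lemma frame_unit : T \in unitmx.
Proof. by have [] := mulmx1_unit frame_mulr. Qed.

Lemma frame_inv : mx_of Pi = invmx T.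
Proof. by rewrite -[LHS](mulKmx frame_unit) frame_mulr mulmx1. Qed.

Lemma mx_of_conj A : mx_of (qconj P Pi A) = invmx T *m mx_of A *m T.
Proof. by rewrite !mx_of_mul frame_inv mulmxA. Qed.

Lemma conj_gen_Sp4 A : A \in gens -> Sp4 (invmx T *m A *m T).
Proof.
case/mapP=> B sB ->; have /andP[_ /allP/(_ _ sB)] := checked.
by move/qeqP; rewrite mx_of_mul mx_of_adj mx_of_id mx_of_conj => /adjsp_Sp4.
Qed.

Lemma Sp4_unit (R : comUnitRingType) (A : 'M[R]_4) : Sp4 A -> A \in unitmx.
Proof. by move=> spA; have [] := mulmx1_unit (adjspKr spA). Qed.

Lemma conj_unit A : Sp4 (invmx T *m A *m T) -> A \in unitmx.
Proof.
by move/Sp4_unit; rewrite !unitmx_mul unitmx_inv frame_unit andbT.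
Qed.

Lemma conjM A B : invmx T *m (A *m B) *m T =
  (invmx T *m A *m T) *m (invmx T *m B *m T).
Proof. by rewrite !mulmxA mulmxK ?frame_unit. Qed.

Lemma conjV A : Sp4 (invmx T *m A *m T) ->
  invmx T *m invmx A *m T = adjsp (invmx T *m A *m T).
Proof.
move=> spA; apply: adjsp_unique => //; rewrite -conjM mulmxV ?conj_unit //.
by rewrite mulmx1 mulVmx ?frame_unit.
Qed.

Lemma generated_Sp4 A : generated gens A -> Sp4 (invmx T *m A *m T).
Proof.
elim=> [|B sB|B C _ spB _ spC|B _ spB].
- by rewrite mulmx1 mulVmx ?frame_unit //; apply: Sp4_1.
- exact: conj_gen_Sp4.
- by rewrite conjM; apply: Sp4_mul.
by rewrite conjV //; apply: Sp4_adjsp.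
Qed.

Lemma conj_group : symplectic_group (conjugate T (generated gens)).
Proof.
split=> [_ [A GA ->]||_ _ [A GA ->] [B GB ->]|_ [A GA ->]].
- exact: generated_Sp4.
- by exists 1%:M; [apply: gen_one | rewrite mulmx1 mulVmx ?frame_unit].
- by exists (A *m B); [apply: gen_mul | rewrite conjM].
- exists (invmx A); first exact: gen_inv.
  by rewrite conjV //; apply: generated_Sp4.
Qed.

Lemma conj_gens : all_in (conjugate T (generated gens)) (map (qconj P Pi) s).
Proof.
move=> i; have [_ G1 _ _] := conj_group.
have [ltis | leis] := ltnP i (size s); last by rewrite nth_default ?size_map // mx_of_id.
rewrite (nth_map qid) // mx_of_conj; exists (mx_of (nth qid s i)) => //.
by apply/gen_mem/map_f/mem_nth.
Qed.

End Frame.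

Definition qsub1 (A : qmx) : qmx :=
  (A.1, ztab (fun i j => zget A.2 i j - (if i == j then A.1 else 0))%coqZ).

Lemma mx_of_sub1 A : ~~ (A.1 =? 0)%coqZ -> mx_of (qsub1 A) = mx_of A - 1%:M.
Proof.
rewrite -rat_of_Z_eq0 => d0; apply/matrixP=> i j; rewrite !mxE zget_tab //.
rewrite rat_of_ZD rat_of_ZN mulrBr -val_eqE /=; congr (_ - _).
by case: eqP => _; rewrite ?mulVf ?mulr0.
Qed.

Definition qzero : qmx := (1%coqZ, ztab (fun _ _ => 0%coqZ)).

Lemma mx_of_zero : mx_of qzero = 0.
Proof.
by rewrite /mx_of; apply/matrixP=> i j; rewrite !mxE zget_tab //= mulr0.
Qed.

Definition qnonzero (A : qmx) : bool :=
  ~~ (A.1 =? 0)%coqZ &&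
  has (fun i => has (fun j => ~~ (zget A.2 i j =? 0)%coqZ) (iota 0 4)) (iota 0 4).

Lemma qnonzeroP A : qnonzero A -> mx_of A <> 0.
Proof.
rewrite /qnonzero -rat_of_Z_eq0 => /andP[d0 /hasP[i iI /hasP[j jI]]] nz A0.
move: iI jI; rewrite !mem_iota /= => ltis ltjs.
move/matrixP/(_ (Ordinal ltis) (Ordinal ltjs))/eqP: A0; rewrite !mxE /=.
by rewrite mulf_eq0 invr_eq0 (negPf d0) rat_of_Z_eq0 (negPf nz).
Qed.

(** The word is evaluated on the matrices conjugated into the frame, where
    inverses are given by [qadj], and conjugated back. *)
Definition unipotent_check (P Pi : qmx) (s : seq qmx) (w : word) : bool :=
  let A := qmul P (qmul (eval_word (map (qconj P Pi) s) w) Pi) in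
  let N := qsub1 A in let N3 := qmul N (qmul N N) in
  [&& ~~ (A.1 =? 0)%coqZ, qeq (qmul N N3) qzero & qnonzero N3].

Lemma unipotent_cert P Pi s w : frame_check P Pi s -> unipotent_check P Pi s w ->
  exists2 A, generated [seq mx_of B | B <- s] A & maximally_unipotent A.
Proof.
move=> chk /and3P[]; set A := qmul P _ => d0 /qeqP N4 /qnonzeroP N3.
have [B GB defB] := eval_word_in (conj_group chk) w (conj_gens chk).
have AE : mx_of A = B.
  rewrite !mx_of_mul defB (frame_inv chk) !mulmxA mulmxV ?(frame_unit chk) //.
  by rewrite mul1mx mulmxK ?(frame_unit chk).
have NE := mx_of_sub1 d0; rewrite AE in NE.
have expN k : (B - 1) ^+ k.+1 = mx_of (qsub1 A) *m (B - 1) ^+ k.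
  by rewrite exprS NE.
exists B => //; split.
- apply: (conj_unit chk); exact: generated_Sp4 chk _ GB.
- by rewrite !expN expr0 mulmx1 -!mx_of_mul N4 mx_of_zero.
by rewrite !expN expr0 mulmx1 -!mx_of_mul.
Qed.

(** Words giving transvections along [e1], [f1], [u = a e1 + e2 + b f1] and
    [w = c e1 + d f1 + f2]; their coefficients as fractions; and the integers
    [(a s, b s, s)] and [(c t, d t, t)], where [s] and [t] clear the
    denominators of [u] and [w]. *)
Record density_data := DensityData {
  w_e1 : word; w_f1 : word; w_u : word; w_w : word;
  k_e1 : Z * Z; k_f1 : Z * Z; k_u : Z * Z; k_w : Z * Z;
  vec_u : Z * Z * Z; vec_w : Z * Z * Z }.

Definition density_check (P Pi : qmx) (s : seq qmx) (D : density_data) : bool :=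
  let g := map (qconj P Pi) s in
  let nz k := ~~ (k =? 0)%coqZ in
  let tr w k x1 x2 y1 y2 s :=
    [&& nz k.1, nz k.2, nz s & qeq (eval_word g w) (qtransv k.1 k.2 x1 x2 y1 y2 s)] in
  let: (a, b, s) := vec_u D in let: (c, d, t) := vec_w D in
  [&& tr (w_e1 D) (k_e1 D) 1 0 0 0 1, tr (w_f1 D) (k_f1 D) 0 0 1 0 1,
      tr (w_u D) (k_u D) a s b 0 s, tr (w_w D) (k_w D) c 0 d t t,
      nz a || nz b & nz c || nz d]%coqZ.

Lemma density_cert P Pi s D : frame_check P Pi s -> density_check P Pi s D ->
  zariski_dense_in_Sp4 (conjugate (mx_of P) (generated [seq mx_of B | B <- s])).
Proof.
move=> chk; have [spG G1 mulG _] := conj_group chk.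
set G := conjugate _ _ in spG G1 mulG *.
have GD w := eval_word_in (conj_group chk) w (conj_gens chk); rewrite -/G in GD.
have transvG w k x1 x2 y1 y2 t : [&& ~~ (k.1 =? 0)%coqZ, ~~ (k.2 =? 0)%coqZ,
     ~~ (t =? 0)%coqZ & qeq (eval_word (map (qconj P Pi) s) w)
                            (qtransv k.1 k.2 x1 x2 y1 y2 t)] ->
   [/\ rat_of_Z k.1 / rat_of_Z k.2 != 0, rat_of_Z t != 0 &
    G (transv (rat_of_Z k.1 / rat_of_Z k.2) (col4 (rat_of_Z x1 / rat_of_Z t)
      (rat_of_Z x2 / rat_of_Z t) (rat_of_Z y1 / rat_of_Z t) (rat_of_Z y2 / rat_of_Z t)))].
  case/and4P=> k1 k2 t0 /qeqP eqw; split.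
  - by rewrite mulf_neq0 ?invr_neq0 ?rat_of_Z_eq0.
  - by rewrite rat_of_Z_eq0.
  by rewrite -mx_of_transv // -eqw; apply: GD.
rewrite /density_check; case: (vec_u D) => [[a b] t]; case: (vec_w D) => [[c d] t'].
case/and5P=> /transvG[k1 _ G1'] /transvG[k2 _ G2] /transvG[k3 t0 G3] /transvG[k4 t'0 G4].
rewrite !divff // !(mul0r, divr1) /= in G1' G2 G3 G4.
case/andP=> abn0 cdn0.
have ratio_n0 x y z : rat_of_Z z != 0 -> ~~ (x =? 0)%coqZ || ~~ (y =? 0)%coqZ ->
    rat_of_Z x / rat_of_Z z != 0 \/ rat_of_Z y / rat_of_Z z != 0.
  rewrite -!rat_of_Z_eq0 => z0 /orP[] nz; [left | right];
    by rewrite mulf_neq0 ?invr_neq0.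
exact: (transv_density spG G1 mulG k1 k2 k3 k4 (ratio_n0 _ _ _ t0 abn0)
  (ratio_n0 _ _ _ t'0 cdn0) G1' G2 G3 G4).
Qed.

(** * Certificates for the nine groups *)

(** Equality with a common denominator cleared, entry by entry, as a
    conjunction of closed rational identities. *)
Fixpoint row_eq (d : Z) (r : seq rat) (z : seq Z) : Prop :=
  match r, z with
  | [::], [::] => True
  | x :: r', y :: z' => x * rat_of_Z d = rat_of_Z y /\ row_eq d r' z'
  | _, _ => False
  end.

Fixpoint rows_eq (d : Z) (rs : seq (seq rat)) (zs : zmx) : Prop :=
  match rs, zs with
  | [::], [::] => True
  | r :: rs', z :: zs' => row_eq d r z /\ rows_eq d rs' zs'
  | _, _ => False
  end.

Lemma mx_of_rowsE rs A : ~~ (A.1 =? 0)%coqZ -> rows_eq A.1 rs A.2 ->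
  mx_of_rows rs = mx_of A.
Proof.
rewrite -rat_of_Z_eq0 => d0 rsA; apply/matrixP=> i j; rewrite !mxE /zget.
suff <- : nth 0 (nth [::] rs i) j * rat_of_Z A.1 = rat_of_Z (nth 0%coqZ (nth [::] A.2 i) j).
  by rewrite mulrC mulfK.
have row_nth r z k : row_eq A.1 r z -> nth 0 r k * rat_of_Z A.1 = rat_of_Z (nth 0%coqZ z k).
  elim: r z k => [|x r IHr] [|y z] k //=; first by rewrite !nth_nil mul0r.
  by case: k => [|k] [xy /IHr rz] /=; rewrite ?xy ?rz.
apply: row_nth; elim: rs A.2 {d0} rsA (i : nat) => [|r rs IHrs] [|z zs] //=.
  by move=> _ [].
by case=> rz rszs [|k] //=; apply: IHrs.
Qed.

(** Letters are written with this constant so that, inside [Z_scope], the index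
    is still read as a natural number. *)
Definition pw (i : nat) (e : Z) : nat * Z := (i, e).

Local Open Scope Z_scope.
(** For each operator: the generators, a symplectic frame with its inverse, and
    the words that certify density and, for all operators but 35, unipotence. *)
Definition source_33 : seq qmx :=
 [:: (4, [:: [:: -4; -16; -96;  64];
            [::  0;   8;   8;  16];
            [::  0;  -4;  -4; -16];
            [::  0;  -1;  -2;   0]]);
     (1, [:: [:: 1; 0; 0; 0];
            [:: 1; 1; 0; 0];
            [:: 0; 0; 1; 0];
            [:: 0; 0; 1; 1]]);
     (2, [:: [::  2; 0; 0;  0];
            [::  0; 2; 0;  0];
            [:: -1; 2; 2; 24];
            [::  0; 0; 0;  2]])].

Definition frame_33 : qmx :=
     (16, [:: [:: 256;  512;  0; -48];
             [::   0;  256;  0;  12];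
             [::   0; -128; 24;   0];
             [::   0;    0;  0;  -3]]).

Definition frame_inv_33 : qmx :=
     (48, [:: [:: 3; -6;  0;  -72];
             [:: 0;  3;  0;   12];
             [:: 0; 16; 32;   64];
             [:: 0;  0;  0; -256]]).

Definition density_33 : density_data := DensityData
  [:: pw 0 2]
  [:: pw 2 1]
  [:: pw 1 1; pw 0 2; pw 1 (-1)]
  [:: pw 0 1; pw 2 1; pw 0 (-1)]
  (3, 1) (16, 3) (3, 1) (256, 3)
  (-3, 16, 3) (-3, -2, 8).

Definition unipotent_33 : word := [:: pw 0 1; pw 1 (-1); pw 2 (-1); pw 0 1; pw 1 (-1); pw 2 (-1)].

Definition source_35 : seq qmx :=
 [:: (8, [:: [:: -8; -192; 256; -4096];
            [::  0;   24; -64;   256];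
            [::  0;    4;  -8;    64];
            [::  0;   -1;   4;    -8]]);
     (1, [:: [:: 1; 0; 0; 0];
            [:: 1; 1; 0; 0];
            [:: 0; 0; 1; 0];
            [:: 0; 0; 1; 1]]);
     (4, [:: [:: 4; 0; 0;   0];
            [:: 0; 4; 0;   0];
            [:: 1; 4; 4; 128];
            [:: 0; 0; 0;   4]])].

Definition frame_35 : qmx :=
     (4, [:: [:: 128; -512;   0; -64];
            [::   0;  128;   0; -16];
            [::   0;   32; -16;   0];
            [::   0;    0;   0;   1]]).

Definition frame_inv_35 : qmx :=
     (32, [:: [:: 1; 4;  0; 128];
             [:: 0; 1;  0;  16];
             [:: 0; 2; -8;  32];
             [:: 0; 0;  0; 128]]).

Definition density_35 : density_data := DensityData
  [:: pw 0 2]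
  [:: pw 2 1]
  [:: pw 1 1; pw 0 2; pw 1 (-1)]
  [:: pw 0 1; pw 2 1; pw 0 (-1)]
  (16, 1) (2, 1) (16, 1) (128, 1)
  (5, 2, 1) (8, 1, 8).

Definition source_97 : seq qmx :=
 [:: (4, [:: [:: -12; 0;  0; -128];
            [::   8; 4;  0;   64];
            [::  -2; 4; -4;  -32];
            [::   1; 0;  0;   12]]);
     (1, [:: [:: 1; 4; -16; 0];
            [:: 0; 1;   0; 0];
            [:: 0; 0;   1; 0];
            [:: 0; 0;   0; 1]]);
     (1, [:: [:: 1; 0; 0; 0];
            [:: 1; 1; 0; 0];
            [:: 0; 0; 1; 0];
            [:: 0; 0; 1; 1]])].

Definition frame_97 : qmx :=
     (4, [:: [:: 0; -64; 16;  8];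
            [:: 0;   0;  0; -8];
            [:: 8;   0;  0; -2];
            [:: 0;   8;  0; -1]]).

Definition frame_inv_97 : qmx :=
     (16, [:: [:: 0; -2; 8;  0];
             [:: 0; -1; 0;  8];
             [:: 4;  0; 0; 32];
             [:: 0; -8; 0;  0]]).

Definition density_97 : density_data := DensityData
  [:: pw 0 2]
  [:: pw 1 1]
  [:: pw 2 1; pw 0 2; pw 2 (-1)]
  [:: pw 0 1; pw 1 1; pw 0 (-1)]
  (4, 1) (8, 1) (4, 1) (128, 1)
  (1, 4, 1) (2, 1, 4).

Definition unipotent_97 : word :=
  [:: pw 0 1; pw 1 1; pw 2 1; pw 1 (-1); pw 2 (-1); pw 0 (-1); pw 1 (-1)].

Definition source_152 : seq qmx :=
 [:: (8, [:: [:: -8; -32; 256; -512];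
            [::  0;   8;   0;    0];
            [::  0;   4;  -8;    0];
            [::  0;   1;  -4;    8]]);
     (16, [:: [:: -48;  0;   0; -2048];
             [::  16; 16;   0;   512];
             [::  -4; 16; -16;  -256];
             [::   1;  0;   0;    48]]);
     (1, [:: [:: 1; 0; 0; 0];
            [:: 1; 1; 0; 0];
            [:: 0; 0; 1; 0];
            [:: 0; 0; 1; 1]])].

Definition frame_152 : qmx :=
     (2, [:: [:: 16; -32;  0;   0];
            [::  0;  16;  0; -16];
            [::  0;   4; -8;  -4];
            [::  0;   1;  0;   0]]).

Definition frame_inv_152 : qmx :=
     (16, [:: [:: 2;  0;  0; 64];
             [:: 0;  0;  0; 32];
             [:: 0;  1; -4;  0];
             [:: 0; -2;  0; 32]]).

Definition density_152 : density_data := DensityData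
  [:: pw 0 2]
  [:: pw 1 2]
  [:: pw 1 1; pw 0 2; pw 1 (-1)]
  [:: pw 2 1; pw 0 2; pw 2 (-1)]
  (16, 1) (2, 1) (16, 1) (16, 1)
  (-1, 1, 1) (-2, -1, 2).

Definition unipotent_152 : word := [:: pw 0 2; pw 1 2; pw 2 (-1); pw 1 (-2); pw 2 1].

Definition source_153 : seq qmx :=
 [:: (8, [:: [:: 8;  0; 0;   0];
            [:: 8;  8; 0; 256];
            [:: 0;  0; 8;   0];
            [:: 0; -1; 8; -24]]);
     (24, [:: [:: -24; -1632; 10752; -56832];
             [::   0;  -728;  3760; -24064];
             [::   0;    32;  -136;   1024];
             [::   0;    27;  -135;    888]]);
     (96, [:: [:: -864;  0;   0; -49152];
             [:: -400; 96;   0; -20480];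
             [::   16; 96; -96;   3584];
             [::   15;  0;   0;    864]])].

Definition frame_153 : qmx :=
     (24, [:: [::  0; 2304; 3072; -1536];
             [:: 48; 1600;    0;  -832];
             [::  0;  -64;    0;    64];
             [:: -3;  -60;    0;    36]]).

Definition frame_inv_153 : qmx :=
     (128, [:: [:: 0; -64; 320; -2048];
              [:: 0;   8;  32;   128];
              [:: 1;  -2;  16;   -32];
              [:: 0;   8;  80;   128]]).

Definition density_153 : density_data := DensityData
  [:: pw 0 2]
  [:: pw 1 2]
  [:: pw 1 1; pw 0 2; pw 1 (-1)]
  [:: pw 2 1; pw 0 2; pw 2 (-1)]
  (128, 1) (1, 1) (128, 1) (128, 1)
  (-2, 1, 2) (3, 0, 1).

Definition unipotent_153 : word := [:: pw 0 1; pw 1 2; pw 2 1; pw 1 (-1); pw 0 1; pw 2 1; pw 1 1].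

Definition source_243 : seq qmx :=
 [:: (160, [:: [:: -160; -32640; 57600; -2380800];
              [::    0;   1720; -5200;   104000];
              [::    0;    144;  -320;     9600];
              [::    0;    -21;    70;    -1240]]);
     (640, [:: [:: -1280; -7680; -76800; -921600];
              [::  -360;  -800; -14400; -172800];
              [::    48;   192;   2560;   23040];
              [::     3;    12;    120;    2080]]);
     (20, [:: [:: 20;  0;  0;    0];
             [::  0; 20;  0;    0];
             [::  1; 20; 20; 1760];
             [::  0;  0;  0;   20]]);
     (2, [:: [:: -2;  0;  0;  0];
            [:: -1; -2;  0;  0];
            [::  0;  0; -2;  0];
            [::  0;  0; -1; -2]])].

Definition frame_243 : qmx :=
     (5760, [:: [:: 1658880; -5760; 704000; -506880000];
               [::       0;  1080; 132000;   -6336000];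
               [::       0;   144; -17600;    7603200];
               [::       0;    -9;  -1100;     475200]]).

Definition frame_inv_243 : qmx :=
     (79200, [:: [:: 275; 1100;   11000;    132000];
                [::   0;    0; 1584000; -25344000];
                [::   0; 3888;  -12960;    259200];
                [::   0;    9;       0;      1080]]).

Definition density_243 : density_data := DensityData
  [:: pw 0 2]
  [:: pw 1 1]
  [:: pw 2 1]
  [:: pw 3 1; pw 0 2; pw 3 (-1)]
  (550, 27) (1944, 275) (35200, 1) (3, 550)
  (275, -324, 39600) (550, 1296, 3).

Definition unipotent_243 : word :=
  [:: pw 1 1; pw 3 1; pw 1 (-1); pw 2 (-1); pw 0 (-1); pw 3 (-1); pw 0 1].

Definition source_248 : seq qmx :=
 [:: (2, [:: [::  2; 0; 0;  0];
            [::  0; 2; 0;  0];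
            [:: -1; 2; 2; 32];
            [::  0; 0; 0;  2]]);
     (1, [:: [:: 1; 4; 16; 32];
            [:: 0; 1;  0;  0];
            [:: 0; 0;  1;  0];
            [:: 0; 0;  0;  1]]);
     (1, [:: [:: 1; 0; 0; 0];
            [:: 1; 1; 0; 0];
            [:: 0; 0; 1; 0];
            [:: 0; 0; 1; 1]]);
     (1, [:: [::  3;  4;  32;  32];
            [:: -1; -1; -16; -16];
            [::  0;  0;   1;   0];
            [::  0;  0;   0;   1]]);
     (2, [:: [::  34;  32;  256; 0];
            [:: -16; -14; -128; 0];
            [::  -2;  -2;  -14; 0];
            [::   1;   1;    8; 2]])].

Definition frame_248 : qmx :=
     (4, [:: [::  0; -8; 256;    0];
            [::  0; -4;   0; -512];
            [:: -2;  1;   0;   64];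
            [::  0;  0;   0;   32]]).

Definition frame_inv_248 : qmx :=
     (64, [:: [:: 0; -32; -128;  -256];
             [:: 0; -64;    0; -1024];
             [:: 1;  -2;    0;   -32];
             [:: 0;   0;    0;     8]]).

Definition density_248 : density_data := DensityData
  [:: pw 0 1]
  [:: pw 1 1]
  [:: pw 3 1]
  [:: pw 4 1]
  (64, 1) (1, 8) (128, 1) (1, 16)
  (8, 1, 16) (64, 4, 1).

Definition unipotent_248 : word := [:: pw 0 1; pw 1 1; pw 3 (-2)].

Definition source_250 : seq qmx :=
 [:: (1, [:: [:: 1; -8; 64; -128];
            [:: 0;  1;  0;    0];
            [:: 0;  0;  1;    0];
            [:: 0;  0;  0;    1]]);
     (1, [:: [:: 1; -4; 0;  0];
            [:: 1; -3; 0;  0];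
            [:: 0;  0; 1; -4];
            [:: 0;  0; 1; -3]]);
     (16, [:: [:: -16; 384; -1280; 3584];
             [::   0; 112;  -384; 1280];
             [::   6;  12;   -80;  448];
             [::   1;  -6;    16;  -16]]);
     (2, [:: [::  2; 0; 0;   0];
            [::  0; 2; 0;   0];
            [:: -1; 2; 2; -16];
            [::  0; 0; 0;   2]])].

Definition frame_250 : qmx :=
     (4, [:: [:: -32; 48; 256; 512];
            [::   0; 16;  64; 256];
            [::   0;  0;   8;  16];
            [::   0; -1;  -4;  -8]]).

Definition frame_inv_250 : qmx :=
     (32, [:: [:: -4;  0;  32; -192];
             [::  0;  0; -64; -128];
             [::  0; -2;  16;  -32];
             [::  0;  1;   0;   16]]).

Definition density_250 : density_data := DensityData
  [:: pw 0 1]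
  [:: pw 2 2]
  [:: pw 3 1]
  [:: pw 1 1; pw 0 1; pw 1 (-1)]
  (-16, 1) (-2, 1) (-32, 1) (-1, 1)
  (-2, -1, 4) (-4, -2, 1).

Definition unipotent_250 : word := [:: pw 0 1; pw 2 1; pw 3 (-2); pw 2 1].

Definition source_266 : seq qmx :=
 [:: (1, [:: [:: 1;  0; 0;  0];
            [:: 0;  1; 0;  0];
            [:: 1; -6; 1; -3];
            [:: 0;  0; 0;  1]]);
     (5, [:: [:: 5; -12; 24;  12];
            [:: 5; -11; -8; -24];
            [:: 0;   3; -1;  -3];
            [:: 0;  -2;  4;   7]]);
     (1, [:: [:: 1; 12; -16; 0];
            [:: 0;  1;   0; 0];
            [:: 0;  0;   1; 0];
            [:: 0;  0;   0; 1]]);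
     (5, [:: [:: 5; 96; -48;  0];
            [:: 0; 13;  -4;  0];
            [:: 0; 36; -13;  0];
            [:: 5; 16; -28; -5]]);
     (1, [:: [:: 5; -12; -16; -12];
            [:: 0;   1;   0;   0];
            [:: 1;  -3;  -3;  -3];
            [:: 0;   0;   0;   1]])].

Definition frame_266 : qmx :=
     (30, [:: [::  0; 504; 36; 12];
             [::  0;  72; 18;  6];
             [:: 30;  54; -9; 12];
             [::  0;  24;  6; -8]]).

Definition frame_inv_266 : qmx :=
     (12, [:: [:: -3;  6; 12;  18];
             [::  1; -2;  0;   0];
             [:: -4; 24;  0;  12];
             [::  0; 12;  0; -36]]).

Definition density_266 : density_data := DensityData
  [:: pw 0 1]
  [:: pw 1 2]
  [:: pw 2 1]
  [:: pw 3 2]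
  (-3, 1) (-8, 1) (-1, 3) (-72, 1)
  (-3, -4, 1) (-3, -2, 6).

Definition unipotent_266 : word := [:: pw 0 1; pw 2 1; pw 1 2; pw 4 (-1)].

Local Close Scope Z_scope.

Lemma eq_cons (T : Type) (x y : T) s t : x = y -> s = t -> x :: s = y :: t.
Proof. by move=> -> ->. Qed.

Ltac source_tac :=
  repeat (apply: eq_cons; [apply: mx_of_rowsE; [by vm_compute|];
    rewrite [_.1]/= [_.2]/= /rows_eq /row_eq /rat_of_Z /rat_of_pos;
    repeat match goal with
           | |- _ /\ _ => apply conj
           | |- True => exact I
           | |- _ => lra
           end|]);
  reflexivity.

Lemma source_33E : generators_33 = map mx_of source_33.
Proof. by rewrite /generators_33; source_tac. Qed.

Lemma frame_33P : frame_check frame_33 frame_inv_33 source_33.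
Proof. by vm_compute. Qed.

Lemma density_33P : density_check frame_33 frame_inv_33 source_33 density_33.
Proof. by vm_compute. Qed.

Lemma unipotent_33P :
  unipotent_check frame_33 frame_inv_33 source_33 unipotent_33.
Proof. by vm_compute. Qed.

Lemma source_35E : generators_35 = map mx_of source_35.
Proof. by rewrite /generators_35; source_tac. Qed.

Lemma frame_35P : frame_check frame_35 frame_inv_35 source_35.
Proof. by vm_compute. Qed.

Lemma density_35P : density_check frame_35 frame_inv_35 source_35 density_35.
Proof. by vm_compute. Qed.

Lemma source_97E : generators_97 = map mx_of source_97.
Proof. by rewrite /generators_97; source_tac. Qed.

Lemma frame_97P : frame_check frame_97 frame_inv_97 source_97.
Proof. by vm_compute. Qed.

Lemma density_97P : density_check frame_97 frame_inv_97 source_97 density_97.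
Proof. by vm_compute. Qed.

Lemma unipotent_97P :
  unipotent_check frame_97 frame_inv_97 source_97 unipotent_97.
Proof. by vm_compute. Qed.

Lemma source_152E : generators_152 = map mx_of source_152.
Proof. by rewrite /generators_152; source_tac. Qed.

Lemma frame_152P : frame_check frame_152 frame_inv_152 source_152.
Proof. by vm_compute. Qed.

Lemma density_152P : density_check frame_152 frame_inv_152 source_152 density_152.
Proof. by vm_compute. Qed.

Lemma unipotent_152P :
  unipotent_check frame_152 frame_inv_152 source_152 unipotent_152.
Proof. by vm_compute. Qed.

Lemma source_153E : generators_153 = map mx_of source_153.
Proof. by rewrite /generators_153; source_tac. Qed.

Lemma frame_153P : frame_check frame_153 frame_inv_153 source_153.
Proof. by vm_compute. Qed.

Lemma density_153P : density_check frame_153 frame_inv_153 source_153 density_153.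
Proof. by vm_compute. Qed.

Lemma unipotent_153P :
  unipotent_check frame_153 frame_inv_153 source_153 unipotent_153.
Proof. by vm_compute. Qed.

Lemma source_243E : generators_243 = map mx_of source_243.
Proof. by rewrite /generators_243; source_tac. Qed.

Lemma frame_243P : frame_check frame_243 frame_inv_243 source_243.
Proof. by vm_compute. Qed.

Lemma density_243P : density_check frame_243 frame_inv_243 source_243 density_243.
Proof. by vm_compute. Qed.

Lemma unipotent_243P :
  unipotent_check frame_243 frame_inv_243 source_243 unipotent_243.
Proof. by vm_compute. Qed.

Lemma source_248E : generators_248 = map mx_of source_248.
Proof. by rewrite /generators_248; source_tac. Qed.

Lemma frame_248P : frame_check frame_248 frame_inv_248 source_248.
Proof. by vm_compute. Qed.

Lemma density_248P : density_check frame_248 frame_inv_248 source_248 density_248.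
Proof. by vm_compute. Qed.

Lemma unipotent_248P :
  unipotent_check frame_248 frame_inv_248 source_248 unipotent_248.
Proof. by vm_compute. Qed.

Lemma source_250E : generators_250 = map mx_of source_250.
Proof. by rewrite /generators_250; source_tac. Qed.

Lemma frame_250P : frame_check frame_250 frame_inv_250 source_250.
Proof. by vm_compute. Qed.

Lemma density_250P : density_check frame_250 frame_inv_250 source_250 density_250.
Proof. by vm_compute. Qed.

Lemma unipotent_250P :
  unipotent_check frame_250 frame_inv_250 source_250 unipotent_250.
Proof. by vm_compute. Qed.

Lemma source_266E : generators_266 = map mx_of source_266.
Proof. by rewrite /generators_266; source_tac. Qed.

Lemma frame_266P : frame_check frame_266 frame_inv_266 source_266.
Proof. by vm_compute. Qed.

Lemma density_266P : density_check frame_266 frame_inv_266 source_266 density_266.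
Proof. by vm_compute. Qed.

Lemma unipotent_266P :
  unipotent_check frame_266 frame_inv_266 source_266 unipotent_266.
Proof. by vm_compute. Qed.

(** * Filling a congruence subgroup *)

(** Take for [t] the part of [a] prime to [b].  A prime divisor of [a] then
    divides exactly one of [b] and [t], and if it divides [b] it cannot divide
    [c].  For [b = 0] this would be the part prime to 0; there [t = 1] works. *)
Lemma coprime_shift (a b c : int) : a != 0 -> coprimez a (gcdz b c) ->
  exists t, coprimez a (b + t * c).
Proof.
move=> a0 cop; have [b0 | b_n0] := eqVneq b 0.
  exists 1; move: cop; rewrite b0 add0r mul1r gcd0z !coprimezE.
  by rewrite absz_id.
pose t : nat := (absz a)`_(\pi(absz b)^').
exists t%:Z; apply/negPn/negP => ncop.
pose g := gcdn (absz a) (absz (b + t%:Z * c)).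
have g_gt1 : (1 < g)%N.
  rewrite ltn_neqAle gcdn_gt0 absz_gt0 a0 andbT eq_sym.
  by move: ncop; rewrite coprimezE.
pose p := pdiv g; have pr_p : prime p := pdiv_prime g_gt1.
have pdvdM x y : (p %| x * y)%Z = (p %| x)%Z || (p %| y)%Z.
  by rewrite !dvdzE abszM Euclid_dvdM.
have pa : (p %| a)%Z by rewrite dvdzE; apply: dvdn_trans (pdiv_dvd _) (dvdn_gcdl _ _).
have ps : (p %| b + t%:Z * c)%Z.
  by rewrite dvdzE; apply: dvdn_trans (pdiv_dvd _) (dvdn_gcdr _ _).
have pi_pa : p \in \pi(absz a) by rewrite mem_primes pr_p absz_gt0 a0.
have [pb | npb] := boolP (p %| b)%Z.
  move: ps; rewrite rpredDl // [_ \in _]pdvdM => /orP[pt | pc].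
    have : p \in \pi(t) by rewrite mem_primes pr_p part_gt0.
    rewrite pi_of_part ?absz_gt0 // !inE => /andP[_ /negP]; apply.
    by rewrite mem_primes pr_p absz_gt0 b_n0.
  have : (p %| gcdz a (gcdz b c))%Z by rewrite !dvdz_gcd pa pb.
  by rewrite (eqP cop) dvdzE /= dvdn1 => /eqP p1; rewrite p1 in pr_p.
apply: (negP npb); move: ps; rewrite rpredDr //= [_ \in _]pdvdM; apply/orP; left.
have : p \in \pi(t).
  rewrite pi_of_part ?absz_gt0 // !inE pi_pa /=.
  by rewrite mem_primes pr_p absz_gt0 b_n0.
by rewrite mem_primes => /and3P[].
Qed.

Definition congr_one (M : int) (A : 'M[int]_4) : Prop :=
  exists X, A = 1%:M + M *: X.

Lemma congr_oneM M A B : congr_one M A -> congr_one M B -> congr_one M (A *m B).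
Proof.
case=> [X ->] [Y ->]; exists (X + Y + M *: (X *m Y)).
rewrite mulmxDl mul1mx mulmxDr mulmx1 -scalemxAl -scalemxAr !scalerDr !scalerA.
by rewrite -!addrA; congr (_ + _); rewrite addrCA.
Qed.

Lemma congr_one_root M t A : root_element (M * t) A -> congr_one M A.
Proof. by case; eexists; rewrite /transv /short -scalerA. Qed.

Section CongruenceFill.
Variables (C : 'M[int]_4 -> Prop) (N : int).
Hypothesis N_gt1 : 1 < N.
Hypothesis mulC : forall A B, C A -> C B -> C (A *m B).
Hypothesis spC : forall A, C A -> Sp4 A.
Hypothesis rootC : forall t A, root_element (N * t) A -> C A.

Let reach x := exists2 B, C B & B *m x = ve2 int.

Let step B x : C B -> reach (B *m x) -> reach x.
Proof. by move=> CB [B' CB' B'x]; exists (B' *m B); [apply: mulC | rewrite -mulmxA]. Qed.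

(** As the [e2] and [f2] coordinates are coprime, some combination of them is 1:
    the first three moves use it to add [N u] to the [e1] coordinate, with
    [u = 1 - a1], and make it [N].  That coordinate then clears the multiples
    of [N ^ 2] in the [e2] and [f2] coordinates, and [e2] clears the rest. *)
Lemma reach_coprime (a1 a2 b1 b2 p q : int) :
  p * (1 + N ^+ 2 * a2) + q * (N ^+ 2 * b2) = 1 ->
  reach (col4 (N * a1) (1 + N ^+ 2 * a2) (N * b1) (N ^+ 2 * b2)).
Proof.
move=> pq1; pose u := 1 - a1.
apply: (step (rootC (Root_e1f2 (N * (- p * u))))); rewrite act_e1f2.
apply: (step (rootC (Root_e1e2 (N * (q * u))))); rewrite act_e1e2.
apply: (step (rootC (Root_e1 (N * (N * (p * u * q * u)))))); rewrite act_e1.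
rewrite [X in col4 X _ _ _](_ : _ = N); last first.
  transitivity (N * a1 + N * u * (p * (1 + N ^+ 2 * a2) + q * (N ^+ 2 * b2))); first by ring.
  by rewrite pq1 /u; ring.
pose m := a2 + q * u * b1; pose n := b2 - p * u * b1.
rewrite [X in col4 _ X _ _](_ : _ = 1 + N ^+ 2 * m); last by rewrite /m; ring.
rewrite [X in col4 _ _ _ X](_ : _ = N ^+ 2 * n); last by rewrite /n; ring.
apply: (step (rootC (Root_e2f1 (N * m)))); rewrite act_e2f1.
rewrite [X in col4 _ X _ _](_ : _ = 1); last by ring.
apply: (step (rootC (Root_f1f2 (N * n)))); rewrite act_f1f2.
rewrite [X in col4 _ _ _ X](_ : _ = 0); last by ring.
rewrite [X in col4 _ _ X _](_ : _ = N * (b1 + m * (N ^+ 2 * n) - n)); last by ring.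
set b := b1 + _ - _.
apply: (step (rootC (Root_f1f2 (N * b)))); rewrite act_f1f2.
apply: (step (rootC (Root_e1f2 (N * 1)))); rewrite act_e1f2.
apply: (step (rootC (Root_f2 (N * (- (b * N)))))); rewrite act_f2.
exists 1%:M; first by rewrite -(transv0 (ve1 _)) -(mulr0 N); apply: rootC (Root_e1 _).
by rewrite mul1mx; apply: eq_col4; ring.
Qed.

(** Two moves add to the [f2] coordinate a multiple of [N g], where [g] is the
    gcd of the [e1] and [f1] coordinates, up to a multiple of the [e2]
    coordinate, and make it coprime to the latter by [coprime_shift];
    primitivity of the column gives the hypothesis of that lemma. *)
Lemma reach_primitive (a1 a2 b1 b2 p1 p2 q1 q2 : int) :
  p1 * (N ^+ 2 * a1) + p2 * (1 + N ^+ 2 * a2) + q1 * (N ^+ 2 * b1) +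
    q2 * (N ^+ 2 * b2) = 1 ->
  reach (col4 (N ^+ 2 * a1) (1 + N ^+ 2 * a2) (N ^+ 2 * b1) (N ^+ 2 * b2)).
Proof.
move=> prim; set x2 := 1 + N ^+ 2 * a2 in prim *.
pose g := gcdz (N ^+ 2 * b1) (N ^+ 2 * a1).
have [al [be gE]] := Bezoutz (N ^+ 2 * b1) (N ^+ 2 * a1); rewrite -/g in gE.
have x2_n0 : x2 != 0.
  apply/eqP => x20; have : (N %| x2 - N ^+ 2 * a2)%Z.
    by rewrite x20 sub0r -mulNr mulNr -mulrN -mulrA dvdz_mulr.
  rewrite /x2 addrK dvdz1 => /eqP absN1.
  by move: N_gt1; lia.
have copN : coprimez x2 N.
  apply/coprimezP; exists (1, - (N * a2)) => /=; rewrite /x2; ring.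
have [k copk] : exists k, coprimez x2 (N ^+ 2 * b2 + k * (N * g)).
  apply: coprime_shift => //.
  set d := gcdz (N ^+ 2 * b2) (N * g); rewrite /coprimez; set e := gcdz x2 d.
  have ex2 : (e %| x2)%Z := dvdz_gcdl _ _.
  have ed : (e %| d)%Z := dvdz_gcdr _ _.
  have eb2 : (e %| N ^+ 2 * b2)%Z := dvdz_trans ed (dvdz_gcdl _ _).
  have eg : (e %| g)%Z.
    have := dvdz_trans ed (dvdz_gcdr _ _); rewrite Gauss_dvdzr //.
    have /coprimezP[[u v] /= uv1] := copN; have /dvdzP[w x2E] := ex2.
    by apply/coprimezP; exists (u * w, v); rewrite /= -uv1 x2E; ring.
  have : (e %| p1 * (N ^+ 2 * a1) + p2 * x2 + q1 * (N ^+ 2 * b1) +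
               q2 * (N ^+ 2 * b2))%Z.
    do !apply: rpredD; apply: dvdz_mull => //.
      by apply: dvdz_trans eg (dvdz_gcdr _ _).
    by apply: dvdz_trans eg (dvdz_gcdl _ _).
  by rewrite prim dvdz1 absz_nat => /eqP absE; rewrite /e /gcdz absE.
pose t := N * (k * al).
apply: (step (rootC (Root_e1f2 t))); rewrite act_e1f2.
apply: (step (rootC (Root_f1f2 (N * (- (k * be)))))); rewrite act_f1f2.
rewrite [X in col4 X _ _ _](_ : _ = N * (N * a1 - k * al * x2)); last by rewrite /t; ring.
rewrite [X in col4 _ _ X _](_ : _ = N * (N * b1 + k * be * x2)); last by ring.
pose b2' := b2 + N * k * (al * b1 + be * a1) - k * be * k * al * x2.
rewrite [X in col4 _ _ _ X](_ : _ = N ^+ 2 * b2'); last by rewrite /t /b2'; ring.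
have : coprimez x2 (N ^+ 2 * b2').
  rewrite [N ^+ 2 * b2'](_ : _ = - (N ^+ 2 * (k * be * k * al)) * x2 +
     (N ^+ 2 * b2 + k * (N * g))).
    by rewrite /coprimez gcdzMDl.
  by rewrite -gE /b2'; ring.
by move/coprimezP=> [[p q] /= pq1]; apply: reach_coprime pq1.
Qed.

End CongruenceFill.

Section CongruenceSubgroup.
Variables (C : 'M[int]_4 -> Prop) (N : int).
Hypothesis N_gt1 : 1 < N.
Hypothesis mulC : forall A B, C A -> C B -> C (A *m B).
Hypothesis spC : forall A, C A -> Sp4 A.
Hypothesis rootC : forall t A, root_element (N * t) A -> C A.
Hypothesis e1C : forall t, C (transv (2 * t) (ve1 int)).
Hypothesis planeC : forall a c : int, (N %| a - 1)%Z -> (N %| c)%Z ->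
  (exists b d, a * d - b * c = 1) ->
  exists al be ga de, [/\ C (plane al be ga de), (2 %| be)%Z, al * de - be * ga = 1,
    al * a + be * c = 1 & ga * a + de * c = 0].

(** Level [N ^ 2] and not [N]: the column [A e2] is cleared by adding multiples
    of [N] times a coordinate that has been made equal to [N], so it must agree
    with [e2] modulo [N ^ 2].  The resulting matrix is still congruent to 1 modulo [N], as [stabilizer_fill] requires.
    There the entry [be] must lie in the ideal, while [planeC] only makes it
    even; a transvection along [e1] with even coefficient corrects it. *)
Lemma congruence_fill A : Sp4 A -> congr_one (N ^+ 2) A ->
  exists2 B, C B & B *m A = 1%:M.
Proof.
move=> spA [X AE].
pose C' B := C B /\ congr_one N B.
have [B [CB congB] BAe2] : exists2 B, C' B & B *m (A *m ve2 int) = ve2 int.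
  have AXe2 : A *m ve2 int = col4 (N ^+ 2 * (X *m ve2 int) 0 0)
      (1 + N ^+ 2 * (X *m ve2 int) 1 0) (N ^+ 2 * (X *m ve2 int) 2 0)
      (N ^+ 2 * (X *m ve2 int) 3 0).
    rewrite AE mulmxDl mul1mx -scalemxAl {1}[X *m _]col4P col4Z col4D.
    by apply: eq_col4; rewrite ?add0r.
  rewrite AXe2; have := Sp4_form (ve2 int) (vf2 int) spA.
  rewrite AXe2 (col4P (A *m vf2 int)) !formE => eq1.
  apply: (@reach_primitive C' N N_gt1 _ _ _ _ _ _
    ((A *m vf2 int) 2 0) ((A *m vf2 int) 3 0)
    (- (A *m vf2 int) 0 0) (- (A *m vf2 int) 1 0)).
  - by move=> D E [CD congD] [CE congE]; split; [apply: mulC | apply: congr_oneM].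
  - by move=> t D rD; split; [apply: rootC rD | apply: congr_one_root rD].
  refine (etrans (etrans _ eq1) _); ring.
have [Y BAE] : congr_one N (B *m A).
  by apply: congr_oneM => //; exists (N *: X); rewrite scalerA -expr2 AE.
rewrite mulmxA in BAe2.
have [] := @stabilizer_fill int (fun t => (N %| t)%Z) C _ _ mulC _ (B *m A).
- by move=> a b; apply: rpredD.
- by move=> a b; apply: dvdz_mull.
- by move=> t D /dvdzP[k ->]; rewrite mulrC; apply: rootC.
- by apply: Sp4_mul => //; apply: spC.
- by move=> i j; rewrite BAE !mxE addrAC subrr add0r dvdz_mulr.
- move=> a c Na Nc det1.
  have [al [be [ga [de [CP /dvdzP[k beE] det eq1 eq0]]]]] := planeC Na Nc det1.
  (* This shift makes the upper right entry [be * (1 - de ^ 2)], and [de = a]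
     is congruent to 1 modulo [N]. *)
  pose s := - (be * de).
  have Ns : exists k, s = 2 * k by exists (- (k * de)); rewrite /s beE; ring.
  have Cs : C (plane (al + s * ga) (be + s * de) ga de).
    have -> : plane (al + s * ga) (be + s * de) ga de =
        plane 1 s 0 1 *m plane al be ga de by rewrite planeM; congr plane; ring.
    by apply: mulC => //; rewrite plane_e1; have [l ->] := Ns; apply: e1C.
  exists (al + s * ga), (be + s * de), ga, de; split=> //.
  - apply: Sp4_plane; rewrite -[RHS]det; ring.
  - have -> : be + s * de = - (be * (de + 1)) * (de - 1) by rewrite /s; ring.
    have eq_a : de * (al * a + be * c) - be * (ga * a + de * c) =
        (al * de - be * ga) * a by ring.
    by move: eq_a; rewrite eq1 eq0 det mulr1 mulr0 subr0 mul1r => ->; apply: dvdz_mull.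
  - transitivity ((al * a + be * c) + s * (ga * a + de * c)); first by ring.
    by rewrite eq1 eq0 mulr0 addr0.
- by [].
- by move=> D CD; rewrite mulmxA => DBA; exists (D *m B) => //; apply: mulC.
Qed.
End CongruenceSubgroup.

(** * A Euclidean algorithm in the plane [e1, f1] *)

(** Matrices [(a, b; c, d)] of determinant 1 with [b] even, [c] divisible by 8
    and [a], [d] congruent to 1 modulo 8.  Such a matrix decreases the second
    coordinate of [(x, y)] when [x / y] lies in the open interval of centre
    [- d / c] and radius [1 / |c|], the trace of its isometric circle.
    Neighbouring circles are tangent at the real line, as the sides of a Ford
    fundamental domain with cusps there. *)
Definition ford_sides : seq (int * int * int * int) :=
  [:: (1, 0, 8, 1); (1, 0, -8, 1); (9, -8, 8, -7); (9, 8, -8, -7);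
      (9, -4, 16, -7); (9, 4, -16, -7); (-7, -4, 16, 9); (-7, 4, -16, 9);
      (-7, 2, 24, -7); (-7, -2, -24, -7); (17, -6, -48, 17); (17, 6, 48, 17);
      (-31, -20, -48, -31); (-31, 20, 48, -31);
      (17, 12, 24, 17); (17, -12, -24, 17)].

(** The sixteen intervals have the form ]p, q[ with p and q consecutive among
    0, 1/4, 1/3, 3/8, 1/2, 5/8, 2/3, 3/4, 1 and their opposites.  An odd first
    coordinate over a second one divisible by 8 excludes all end points but
    3/8 and 5/8, with sign, which are excluded by hypothesis. *)
Lemma ford_reduce_pos (r t : int) : 0 < t -> `|2 * r + 1| <= 8 * t ->
  (forall k, k \in [:: 3; -3; 5; -5] -> 2 * r + 1 != k * t) ->
  exists q, q \in ford_sides /\ `|q.1.2 * (2 * r + 1) + q.2 * (8 * t)| < 8 * t.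
Proof.
move=> t0 le_xt excl; set x := 2 * r + 1 in le_xt excl *.
have [x_def n3 nm3 n5 nm5] : [/\ x = 2 * r + 1, x != 3 * t, x != -3 * t, x != 5 * t & x != -5 * t].
  by split=> //; apply: excl.
move: excl => _; clearbody x.
have side a b c d : (a, b, c, d) \in ford_sides -> `|c * x + d * (8 * t)| < 8 * t ->
    exists q, q \in ford_sides /\ `|q.1.2 * x + q.2 * (8 * t)| < 8 * t.
  by move=> *; exists (a, b, c, d).
have [x0 | x0] := ltP 0 x.
  have [?|?] := ltP x (2 * t); first by apply: (side 1 0 (-8) 1) => //; lia.
  have [?|?] := ltP (3 * x) (8 * t); first by apply: (side (-7) 2 24 (-7)) => //; lia.
  have [?|?] := ltP x (3 * t); first by apply: (side 17 (-6) (-48) 17) => //; lia.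
  have [?|?] := ltP x (4 * t); first by apply: (side 9 (-4) 16 (-7)) => //; lia.
  have [?|?] := ltP x (5 * t); first by apply: (side (-7) 4 (-16) 9) => //; lia.
  have [?|?] := ltP (3 * x) (16 * t); first by apply: (side (-31) 20 48 (-31)) => //; lia.
  have [?|?] := ltP x (6 * t); first by apply: (side 17 (-12) (-24) 17) => //; lia.
  by apply: (side 9 (-8) 8 (-7)) => //; lia.
have [?|?] := ltP (-2 * t) x; first by apply: (side 1 0 8 1) => //; lia.
have [?|?] := ltP (-8 * t) (3 * x); first by apply: (side (-7) (-2) (-24) (-7)) => //; lia.
have [?|?] := ltP (-3 * t) x; first by apply: (side 17 6 48 17) => //; lia.
have [?|?] := ltP (-4 * t) x; first by apply: (side 9 4 (-16) (-7)) => //; lia.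
have [?|?] := ltP (-5 * t) x; first by apply: (side (-7) (-4) 16 9) => //; lia.
have [?|?] := ltP (-16 * t) (3 * x); first by apply: (side (-31) (-20) (-48) (-31)) => //; lia.
have [?|?] := ltP (-6 * t) x; first by apply: (side 17 12 24 17) => //; lia.
by apply: (side 9 8 (-8) (-7)) => //; lia.
Qed.

Lemma ford_reduce (r t : int) : t != 0 -> `|2 * r + 1| <= `|8 * t| ->
  (forall k, k \in [:: 3; -3; 5; -5] -> 2 * r + 1 != k * t) ->
  exists q, q \in ford_sides /\ `|q.1.2 * (2 * r + 1) + q.2 * (8 * t)| < `|8 * t|.
Proof.
move=> t_n0 le_xt excl; have [t0 | t0] := ltP 0 t.
  have t8 : `|8 * t| = 8 * t by lia.
  by rewrite t8 in le_xt *; apply: ford_reduce_pos.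
have t8 : `|8 * t| = 8 * (- t) by lia.
rewrite t8 in le_xt *.
have [||k k_in|q [q_in q_lt]] := @ford_reduce_pos (- r - 1) (- t); first by lia.
- by rewrite (_ : 2 * (- r - 1) + 1 = - (2 * r + 1)) ?normrN //; ring.
- have := excl k k_in; apply: contraNN => /eqP xk; apply/eqP.
  by rewrite -[LHS]opprK -[RHS]opprK; congr (- _); rewrite -mulrN -xk; ring.
exists q; split=> //; rewrite -normrN; congr (`|_| < _): q_lt; ring.
Qed.

Section PlaneReduce.
Variable C : 'M[int]_4 -> Prop.
Hypothesis mulC : forall A B, C A -> C B -> C (A *m B).
Hypothesis e1C : forall t, C (transv (2 * t) (ve1 int)).
Hypothesis fordC : forall a b c d, (a, b, c, d) \in ford_sides -> C (plane a b c d).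

(** Euclidean algorithm: transvections along [e1] reduce [x] modulo [2 y] to
    [|x| <= |y|], then a matrix of [ford_sides] decreases [|y|].  The excluded
    quotients [k / 8], for [k] among 3, -3, 5, -5, would make [y / 8] a unit
    and [x] equal to [k] or [- k], which is not 1 modulo 8. *)
Lemma plane_reduce (x y : int) : (8 %| x - 1)%Z -> (8 %| y)%Z ->
  (exists b d, x * d - b * y = 1) ->
  exists al be ga de, [/\ C (plane al be ga de), (2 %| be)%Z, al * de - be * ga = 1,
    al * x + be * y = 1 & ga * x + de * y = 0].
Proof.
pose red x y := exists al be ga de, [/\ C (plane al be ga de), (2 %| be)%Z,
  al * de - be * ga = 1, al * x + be * y = 1 & ga * x + de * y = 0].
suff redP n : forall x y, (absz y < n)%N -> (8 %| x - 1)%Z -> (8 %| y)%Z ->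
    (exists b d, x * d - b * y = 1) -> red x y.
  by move=> x1 y0 det1; exact: (redP _ _ _ (ltnSn (absz y))).
have red_mul a b c d : C (plane a b c d) -> (2 %| b)%Z -> a * d - b * c = 1 ->
    forall x0 y0, red (a * x0 + b * y0) (c * x0 + d * y0) -> red x0 y0.
  move=> CP b2 det1 x0 y0 [al [be [ga [de [CP' be2 det2 eq1 eq0]]]]].
  exists (al * a + be * c), (al * b + be * d), (ga * a + de * c), (ga * b + de * d).
  split.
  - by rewrite -planeM; apply: mulC.
  - by apply: rpredD; [apply: dvdz_mull | apply: dvdz_mulr].
  - by rewrite -[RHS]mulr1 -{1}det1 -det2; ring.
  - by rewrite -eq1; ring.
  - by rewrite -eq0; ring.
have red_e1 k x0 y0 : red (x0 + 2 * k * y0) y0 -> red x0 y0.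
  move=> redx; apply: (@red_mul 1 (2 * k) 0 1).
  - by rewrite plane_e1.
  - by rewrite dvdz_mulr.
  - by ring.
  by rewrite !mul1r mul0r add0r.
elim: n => // n IHn {}x {}y le_yn x1 y0 [b [d det1]].
have /dvdzP[t yE] := y0.
have [y_0 | y_n0] := eqVneq y 0.
  have x_1 : x = 1.
    have : (x %| 1)%Z by apply/dvdzP; exists d; refine (etrans (esym det1) _); rewrite y_0; ring.
    by have /dvdzP[s] := x1; rewrite dvdz1; lia.
  exists 1, 0, 0, 1; rewrite x_1 y_0; split; try by ring.
    by rewrite plane_e1 -(mulr0 2); apply: e1C.
  by rewrite dvdz0.
have [k le_x'y] : exists k, `|x + 2 * k * y| <= `|y|.
  have y2 : 0 < 2 * `|y| by lia.
  have := divz_eq (x + `|y|) (2 * `|y|); have := modz_ge0 (x + `|y|) (lt0r_neq0 y2).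
  have := ltz_pmod (x + `|y|) y2.
  move: (_ %% _)%Z (_ %/ _)%Z => r q ltr r0 eqx.
  have [y_gt0 | y_le0] := ltP 0 y.
    exists (- q); have yy : `|y| = y by lia.
    by rewrite yy in eqx ltr *; rewrite (_ : x + _ = r - y); [lia | lra].
  exists q; have yy : `|y| = - y by lia.
  by rewrite yy in eqx ltr *; rewrite (_ : x + _ = r + y); [lia | lra].
apply: (red_e1 k); set x' := x + _ in le_x'y *.
have x'1 : (8 %| x' - 1)%Z.
  by rewrite /x' addrAC rpredD // dvdz_mull.
pose b' := b + 2 * k * d.
have det1' : x' * d - b' * y = 1 by rewrite -det1 /x' /b'; ring.
have /dvdzP[s sE] := x'1.
have xE : x' = 2 * (4 * s) + 1 by lra.
have t_n0 : t != 0 by apply: contraNneq y_n0 => t0; rewrite yE t0 mul0r.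
have yE' : y = 8 * t by rewrite yE mulrC.
have [|j j_in|[[[a1 b1] c1] d1] [q_in /= q_lt]] := @ford_reduce (4 * s) t t_n0.
- by rewrite -xE -yE'.
- rewrite -xE; apply/eqP => x'E.
  have : (t %| 1)%Z by apply/dvdzP; exists (j * d - 8 * b');
    refine (etrans (esym det1') _); rewrite x'E yE'; ring.
  rewrite dvdz1 => t1; move: j_in; rewrite !inE.
  by case/or4P=> /eqP jE; rewrite jE in x'E; lia.
rewrite -xE -yE' in q_lt.
have /allP/(_ _ q_in)/and4P[/= a8 b2 c8 /eqP det2] :
  all (fun q => [&& (8 %| q.1.1.1 - 1)%Z, (2 %| q.1.1.2)%Z, (8 %| q.1.2)%Z &
    q.1.1.1 * q.2 - q.1.1.2 * q.1.2 == 1]) ford_sides by [].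
apply: (@red_mul a1 b1 c1 d1); [exact: fordC | by [] | by [] |].
apply: IHn.
- by move: (_ + _) q_lt => z q_lt; lia.
- have -> : a1 * x' + b1 * y - 1 = (a1 - 1) * x' + (x' - 1) + b1 * y by ring.
  by apply: rpredD; [apply: rpredD => //; apply: dvdz_mulr | apply: dvdz_mull].
- by apply: rpredD; [apply: dvdz_mulr | apply: dvdz_mull].
exists (a1 * b' + b1 * d), (c1 * b' + d1 * d).
by rewrite -[RHS]mulr1 -{1}det2 -det1'; ring.
Qed.
End PlaneReduce.

(** * Explicit elements of the group of operator 250 *)

Definition imx (M : zmx) : 'M[int]_4 := \matrix_(i < 4, j < 4) int_of_Z (zget M i j).

Lemma mx_of_int M : mx_of (1%coqZ, M) = map_mx intr (imx M).
Proof.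
by rewrite /mx_of invr1 scale1r; apply/matrixP=> i j; rewrite !mxE rat_of_ZE.
Qed.

Lemma map_intr_inj : injective (map_mx intr : 'M[int]_4 -> 'M[rat]_4).
Proof.
move=> A B /matrixP eqAB; apply/matrixP=> i j; apply/eqP.
by have := eqAB i j; rewrite !mxE => /eqP; rewrite eqr_int.
Qed.

Lemma Sp4_intr (A : 'M[int]_4) : Sp4 (map_mx intr A : 'M[rat]_4) -> Sp4 A.
Proof.
rewrite /Sp4 map_trmx -(map_Omega (intr : {rmorphism int -> rat})) -!map_mxM.
exact: map_intr_inj.
Qed.

Definition qplane (a b c d : Z) : qmx :=
  (1, [:: [:: a; 0; b; 0]; [:: 0; 1; 0; 0]; [:: c; 0; d; 0]; [:: 0; 0; 0; 1]])%coqZ.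

Lemma mx_of_plane a b c d : mx_of (qplane a b c d) =
  map_mx intr (plane (int_of_Z a) (int_of_Z b) (int_of_Z c) (int_of_Z d)).
Proof.
rewrite mx_of_int; congr (map_mx _ _); apply/matrixP=> i j; rewrite !mxE.
by case: i j => [] [|[|[|[|//]]]] ? [] [|[|[|[|//]]]] ?.
Qed.

Definition zcol (v : seq Z) : 'cV[int]_4 := \col_i int_of_Z (nth 0%coqZ v i).

Definition qlong (k : Z) (v : seq Z) : qmx :=
  let x i := nth 0%coqZ v i in qtransv k 1 (x 0) (x 1) (x 2) (x 3) 1.

Lemma mx_of_long k v : mx_of (qlong k v) = map_mx intr (transv (int_of_Z k) (zcol v)).
Proof.
rewrite mx_of_transv // !divr1 (map_transv (intr : {rmorphism int -> rat})) /=.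
by rewrite [zcol v]col4P map_col4 !mxE !rat_of_ZE.
Qed.

Definition qshort (k : Z) (v w : seq Z) : qmx :=
  qmul (qlong k [seq (p.1 + p.2)%coqZ | p <- zip v w])
       (qmul (qlong (- k) v) (qlong (- k) w)).

Lemma mx_of_short k v w : size v = 4 -> size w = 4 -> spform (zcol v) (zcol w) = 0 ->
  mx_of (qshort k v w) = map_mx intr (short (int_of_Z k) (zcol v) (zcol w)).
Proof.
move=> sv sw vw0; rewrite (short_transv _ vw0) !mx_of_mul mulmxA !mx_of_long !map_mxM /=.
have -> : zcol [seq (p.1 + p.2)%coqZ | p <- zip v w] = zcol v + zcol w.
  apply/matrixP=> i j; rewrite !mxE (nth_map (0%coqZ, 0%coqZ)) ?size_zip ?sv ?sw //.
  by rewrite nth_zip ?sv ?sw // rmorphD.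
by rewrite rmorphN.
Qed.

Local Open Scope Z_scope.

(** The frame [T250], and the generators written in it. *)
Definition source_T250 : qmx :=
     (1, [:: [:: 32; -16;  0;  0];
            [:: 16;   0;  0; 16];
            [::  0;   0; -2;  0];
            [:: -1;   0; -1;  0]]).

Definition inverse_T250 : qmx :=
     (16, [:: [::  0; 0;  8; -16];
             [:: -1; 0; 16; -32];
             [::  0; 0; -8;   0];
             [::  0; 1; -8;  16]]).

Definition integral_250 : seq qmx :=
 [:: (1, [:: [:: 1; 0; 0; 0];
            [:: 0; 1; 0; 8];
            [:: 0; 0; 1; 0];
            [:: 0; 0; 0; 1]]);
     (1, [:: [:: -1;  0;  0;  0];
            [::  0;  1;  0;  4];
            [:: -2;  0; -1;  0];
            [::  0; -1;  0; -3]]);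
     (1, [:: [::  1; -2;  -8; 12];
            [:: -6; -5; -12;  0];
            [::  2;  3;   9; -6];
            [::  1;  2;   6; -5]]);
     (1, [:: [::  5;  4;  4;  8];
            [::  8;  9;  8; 16];
            [:: -4; -4; -3; -8];
            [:: -4; -4; -4; -7]])].

(** The columns form a symplectic basis of the integral lattice, in the order
    [e1, e2, f1, f2], adapted to the group: [e1] and [f1] span the plane in
    which the Euclidean algorithm is run. *)
Definition basis_250 : qmx :=
     (1, [:: [::  0;  1; 0; 0];
            [::  2; -2; 1; 0];
            [:: -2;  0; 0; 1];
            [:: -1;  0; 0; 0]]).

(** A straight-line program on the four integral generators: lines are numbered
    from 4 on. *)
Definition program_250 : seq word :=
 [:: [:: pw 0 1; pw 1 1; pw 3 1; pw 2 1];
     [:: pw 0 1; pw 2 (-1); pw 3 (-1); pw 4 (-2); pw 2 (-2); pw 4 (-1)];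
     [:: pw 1 1; pw 0 (-1); pw 1 28; pw 3 (-1); pw 1 1; pw 0 1; pw 1 (-1);
        pw 3 (-1); pw 1 (-1); pw 0 (-1); pw 2 (-2); pw 4 (-1); pw 2 2; pw 4 1;
        pw 3 2; pw 1 5; pw 0 1; pw 1 (-1)];
     [:: pw 1 1; pw 0 (-1); pw 1 (-7); pw 2 3; pw 4 2; pw 1 1; pw 3 1;
        pw 2 1; pw 3 1; pw 0 1; pw 1 (-1)];
     [:: pw 1 1; pw 0 (-1); pw 1 1; pw 4 1; pw 2 2; pw 4 2; pw 3 1; pw 2 1;
        pw 1 (-1)];
     [:: pw 6 (-1); pw 7 (-4); pw 8 (-2)];
     [:: pw 5 1; pw 9 (-1); pw 1 1];
     [:: pw 4 2];
     [:: pw 1 (-2)];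
     [:: pw 1 8; pw 3 (-1); pw 2 (-1); pw 3 (-1); pw 1 (-1); pw 4 (-2);
        pw 2 (-3)];
     [:: pw 1 5; pw 4 1; pw 2 2; pw 4 2; pw 3 1; pw 2 1; pw 0 (-1)];
     [:: pw 2 (-1); pw 3 1; pw 2 1];
     [:: pw 1 1; pw 3 1; pw 1 (-1)];
     [:: pw 2 2];
     [:: pw 1 1; pw 17 1; pw 1 (-1)];
     [:: pw 16 1; pw 18 1; pw 16 (-1)];
     [:: pw 0 1; pw 19 1; pw 0 (-1)];
     [:: pw 2 1; pw 3 1; pw 2 (-1)];
     [:: pw 3 1; pw 21 1; pw 3 (-1)];
     [:: pw 1 1; pw 22 1; pw 1 (-1)];
     [:: pw 11 (-1); pw 23 1; pw 11 1];
     [:: pw 20 (-1); pw 24 1; pw 20 1];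
     [:: pw 19 (-1); pw 25 1; pw 19 1];
     [:: pw 16 1; pw 26 1; pw 16 (-1)];
     [:: pw 1 1; pw 27 1; pw 1 (-1)];
     [:: pw 0 16; pw 15 (-1); pw 28 (-1)];
     [:: pw 4 (-2); pw 2 (-2)];
     [:: pw 1 1; pw 0 1; pw 1 (-1)];
     [:: pw 1 1; pw 31 1; pw 1 (-1)];
     [:: pw 3 1; pw 32 1; pw 3 (-1)];
     [:: pw 2 1; pw 33 1; pw 2 (-1)];
     [:: pw 11 (-1); pw 15 1; pw 11 1];
     [:: pw 17 (-1); pw 35 1; pw 17 1];
     [:: pw 17 (-1); pw 36 1; pw 17 1];
     [:: pw 3 1; pw 37 1; pw 3 (-1)];
     [:: pw 34 1; pw 38 1; pw 34 (-1)];
     [:: pw 17 (-1); pw 39 1; pw 17 1];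
     [:: pw 17 (-1); pw 40 1; pw 17 1];
     [:: pw 1 (-1); pw 0 1; pw 1 1];
     [:: pw 1 (-1); pw 42 1; pw 1 1];
     [:: pw 1 (-1); pw 43 1; pw 1 1];
     [:: pw 16 (-1); pw 44 1; pw 16 1];
     [:: pw 0 1; pw 45 1; pw 0 (-1)];
     [:: pw 11 1; pw 46 1; pw 11 (-1)];
     [:: pw 20 1; pw 47 1; pw 20 (-1)];
     [:: pw 3 (-1); pw 48 1; pw 3 1];
     [:: pw 1 (-1); pw 3 1; pw 1 1];
     [:: pw 3 (-1); pw 49 1; pw 3 1];
     [:: pw 31 1; pw 51 1; pw 31 (-1)];
     [:: pw 34 1; pw 52 1; pw 34 (-1)];
     [:: pw 50 (-1); pw 53 1; pw 50 1];
     [:: pw 1 1; pw 16 1; pw 1 (-1)];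
     [:: pw 1 1; pw 32 1; pw 1 (-1)];
     [:: pw 55 1; pw 56 1; pw 55 (-1)];
     [:: pw 0 1; pw 57 1; pw 0 (-1)];
     [:: pw 0 1; pw 58 1; pw 0 (-1)];
     [:: pw 3 1; pw 59 1; pw 3 (-1)];
     [:: pw 41 (-64); pw 49 (-296); pw 54 70; pw 60 57];
     [:: pw 11 (-1); pw 2 (-1); pw 3 (-1); pw 12 1; pw 9 1; pw 13 (-1);
        pw 1 (-1); pw 13 1; pw 14 1; pw 1 1; pw 0 (-1); pw 1 1; pw 29 (-1);
        pw 1 1; pw 3 1; pw 2 1; pw 30 (-1); pw 61 1];
     [:: pw 62 1; pw 0 4];
     [:: pw 10 1; pw 63 1; pw 10 (-1); pw 63 (-1)];
     [:: pw 63 1; pw 64 1; pw 63 (-1); pw 64 (-1)];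
     [:: pw 64 2; pw 65 (-1)];
     [:: pw 1 (-1); pw 0 1; pw 2 (-1); pw 3 (-1); pw 4 (-2); pw 2 (-2);
        pw 4 (-1)];
     [:: pw 5 1; pw 67 1; pw 9 1; pw 1 (-1)];
     [:: pw 63 128; pw 65 1];
     [:: pw 0 (-2); pw 1 1; pw 3 1; pw 2 1; pw 4 2; pw 2 2; pw 4 1; pw 2 2;
        pw 4 1; pw 2 2; pw 4 1; pw 0 1; pw 1 1; pw 3 1; pw 2 (-1); pw 4 1;
        pw 0 (-1)];
     [:: pw 70 (-1); pw 9 (-1)];
     [:: pw 0 (-1)];
     [:: pw 1 (-1); pw 0 (-1); pw 70 (-1); pw 13 1; pw 67 1];
     [:: pw 1 6; pw 3 (-1); pw 2 (-1); pw 3 (-1); pw 1 (-1); pw 4 (-2);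
        pw 2 (-3)];
     [:: pw 74 (-1); pw 70 1; pw 0 1; pw 5 (-1)];
     [:: pw 1 (-4); pw 0 1; pw 2 (-1); pw 3 (-1); pw 4 (-2); pw 2 (-2);
        pw 4 (-1)];
     [:: pw 1 9; pw 3 (-1); pw 2 (-1); pw 3 (-1); pw 1 (-1); pw 4 (-2);
        pw 2 (-3)];
     [:: pw 3 1; pw 0 1; pw 1 (-1); pw 9 1; pw 76 (-1); pw 1 1; pw 0 (-1);
        pw 1 1; pw 29 (-1); pw 0 (-1); pw 4 (-1); pw 11 1; pw 30 (-1);
        pw 61 1; pw 11 (-2); pw 2 1; pw 30 (-1); pw 0 1; pw 13 1; pw 77 1];
     [:: pw 1 7; pw 3 (-1); pw 2 (-1); pw 3 (-1); pw 1 (-1); pw 4 (-2);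
        pw 2 (-3)];
     [:: pw 0 1; pw 55 1; pw 0 (-1)];
     [:: pw 17 (-1); pw 80 1; pw 17 1];
     [:: pw 2 (-1); pw 81 1; pw 2 1];
     [:: pw 3 (-1); pw 82 1; pw 3 1];
     [:: pw 1 (-1); pw 83 1; pw 1 1];
     [:: pw 0 16; pw 23 (-1); pw 84 (-1)];
     [:: pw 3 1; pw 1 (-7); pw 0 1; pw 2 (-1); pw 3 (-1); pw 4 (-2);
        pw 2 (-2); pw 4 (-1); pw 3 (-1)];
     [:: pw 3 1; pw 1 (-1); pw 3 (-2); pw 4 (-1); pw 2 (-2); pw 4 1;
        pw 2 2; pw 0 1; pw 1 1; pw 3 1; pw 1 1; pw 0 (-1); pw 1 (-1)];
     [:: pw 3 1; pw 1 (-1); pw 2 3; pw 4 2; pw 1 1; pw 3 1; pw 2 1];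
     [:: pw 86 (-2); pw 87 (-1); pw 88 4];
     [:: pw 79 (-1); pw 13 (-1); pw 0 (-1); pw 30 1; pw 2 (-1); pw 85 (-1);
        pw 89 1; pw 3 1; pw 1 1; pw 2 1; pw 1 1; pw 89 (-1); pw 85 (-1);
        pw 30 1; pw 11 (-1); pw 4 1; pw 5 1; pw 61 (-1); pw 2 1; pw 0 (-1);
        pw 5 (-1)];
     [:: pw 90 (-1)];
     [:: pw 78 (-1)];
     [:: pw 1 1; pw 11 1; pw 1 (-1)];
     [:: pw 1 1; pw 20 1; pw 1 (-1)];
     [:: pw 18 (-6); pw 93 (-16); pw 94 (-3)];
     [:: pw 1 (-1); pw 61 (-1); pw 30 1; pw 2 (-1); pw 3 (-1); pw 1 (-1);
        pw 29 1; pw 1 (-1); pw 0 1; pw 1 (-1); pw 14 (-1); pw 13 (-1); pw 9 1;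
        pw 1 (-1); pw 85 1; pw 3 (-1); pw 1 (-1); pw 29 (-1); pw 95 (-1);
        pw 1 1; pw 30 (-1); pw 2 1];
     [:: pw 0 1; pw 96 (-1)];
     [:: pw 96 1; pw 0 (-1)];
     [:: pw 1 (-1); pw 9 1; pw 13 1; pw 70 (-1); pw 61 1; pw 70 (-1);
        pw 1 1; pw 70 (-1); pw 13 (-1)];
     [:: pw 99 (-1); pw 0 1; pw 96 (-1)];
     [:: pw 96 1; pw 0 (-1); pw 99 1];
     [:: pw 1 1; pw 0 1; pw 2 (-1); pw 3 (-1); pw 4 (-2); pw 2 (-2);
        pw 4 (-1)];
     [:: pw 1 1; pw 0 (-1); pw 11 (-1); pw 0 1; pw 89 1; pw 3 1; pw 30 1;
        pw 4 (-1); pw 102 (-1); pw 31 1; pw 1 1; pw 30 1; pw 11 (-3); pw 30 1;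
        pw 11 (-1); pw 4 1; pw 30 2; pw 1 (-1); pw 31 (-1); pw 3 (-1); pw 1 1];
     [:: pw 78 1; pw 103 (-1); pw 90 (-1)];
     [:: pw 90 1; pw 103 1; pw 78 (-1)];
     [:: pw 1 2; pw 4 1; pw 2 2; pw 4 2; pw 3 1; pw 2 1; pw 0 (-1)];
     [:: pw 106 (-1); pw 70 1; pw 61 1; pw 70 (-1); pw 106 1];
     [:: pw 107 1; pw 78 1; pw 103 (-1); pw 90 (-1)];
     [:: pw 90 1; pw 103 1; pw 78 (-1); pw 107 (-1)]].

(** Lines of the program that act on the plane [e1, f1] of the new basis, in
    the order of [ford_sides]. *)
Definition planes_250 : seq (nat * (Z * Z * Z * Z)) :=
 [:: (72%N, (1, 0, 8, 1));
     (0%N, (1, 0, -8, 1));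
     (73%N, (9, -8, 8, -7));
     (75%N, (9, 8, -8, -7));
     (78%N, (9, -4, 16, -7));
     (90%N, (9, 4, -16, -7));
     (91%N, (-7, -4, 16, 9));
     (92%N, (-7, 4, -16, 9));
     (97%N, (-7, 2, 24, -7));
     (98%N, (-7, -2, -24, -7));
     (100%N, (17, -6, -48, 17));
     (101%N, (17, 6, 48, 17));
     (104%N, (-31, -20, -48, -31));
     (105%N, (-31, 20, 48, -31));
     (108%N, (17, 12, 24, 17));
     (109%N, (17, -12, -24, 17))].

(** Lines of the program that are root elements in the new basis; 2048 is a
    multiple of each coefficient. *)
Definition levels_250 : seq (nat * qmx) :=
  let e1 := [:: 1; 0; 0; 0] in let e2 := [:: 0; 1; 0; 0] in
  let f1 := [:: 0; 0; 1; 0] in let f2 := [:: 0; 0; 0; 1] in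
 [:: (10%N, qlong (-2) e1); (65%N, qlong 1024 e2); (0%N, qlong 8 f1);
     (9%N, qlong (-8) f2); (66%N, qshort 64 e1 e2); (68%N, qshort 8 e1 f2);
     (69%N, qshort (-2048) e2 f1); (71%N, qshort 16 f1 f2)].

Local Close Scope Z_scope.

Lemma T250E : T250 = mx_of source_T250.
Proof.
apply: mx_of_rowsE; [by vm_compute|].
rewrite [_.1]/= [_.2]/= /rows_eq /row_eq /rat_of_Z /rat_of_pos.
by repeat split; lra.
Qed.

Lemma frame_T250P : frame_check source_T250 inverse_T250 source_250.
Proof. by vm_compute. Qed.

Lemma integral_250P : all2 qeq (map (qconj source_T250 inverse_T250) source_250) integral_250.
Proof. by vm_compute. Qed.

Definition in_basis (A : qmx) : qmx := qmul basis_250 (qmul A (qadj basis_250)).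

Lemma levels_250P : let lines := run integral_250 program_250 in
  all (fun l => qeq (nth qid lines l.1) (in_basis l.2)) levels_250.
Proof. by vm_compute. Qed.

Lemma planes_250P : let lines := run integral_250 program_250 in
  all (fun l => let: (i, (a, b, c, d)) := l in
    qeq (nth qid lines i) (in_basis (qplane a b c d))) planes_250.
Proof. by vm_compute. Qed.

Lemma planes_ford_sides :
  [seq (let: (_, (a, b, c, d)) := l in
     (int_of_Z a, int_of_Z b, int_of_Z c, int_of_Z d)) | l <- planes_250] = ford_sides.
Proof. by []. Qed.

(** * Finite index of a group containing a congruence subgroup *)

Section Powers.
Variable C : 'M[int]_4 -> Prop.
Hypothesis C1 : C 1%:M.
Hypothesis mulC : forall A B, C A -> C B -> C (A *m B).
Hypothesis adjC : forall A, C A -> C (adjsp A).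

Lemma multiples_closed (f : int -> 'M[int]_4) k :
  (forall s t, f s *m f t = f (s + t)) -> f 0 = 1%:M -> (forall s, Sp4 (f s)) ->
  C (f k) -> forall t, C (f (k * t)).
Proof.
move=> fD f0 spf Cf; have natC n : C (f (k * n%:Z)).
  elim: n => [|n IHn]; first by rewrite mulr0 f0.
  by rewrite -add1n PoszD mulrDr mulr1 -fD; apply: mulC.
move=> t; case: (intP t) => [|n|n]; [exact: (natC 0) | exact: natC |].
have -> : f (k * - n.+1%:Z) = adjsp (f (k * n.+1%:Z)).
  apply: adjsp_unique => //; by rewrite fD mulrN subrr.
exact: adjC.
Qed.

Lemma transv_multiples k v : C (transv k v) -> forall t, C (transv (k * t) v).
Proof.
apply: (@multiples_closed (fun t => transv t v)) => [s t||s].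
- exact: transvD.
- exact: transv0.
exact: Sp4_transv.
Qed.

Lemma short_multiples k v w : spform v w = 0 -> C (short k v w) ->
  forall t, C (short (k * t) v w).
Proof.
move=> vw0; apply: (@multiples_closed (fun t => short t v w)) => [s t||s].
- exact: shortD.
- by rewrite /short scale0r addr0.
by rewrite short_transv //; do !apply: Sp4_mul; apply: Sp4_transv.
Qed.
End Powers.

Lemma Sp4Z_subgroup : is_subgroup Sp4Z.
Proof.
split=> [_ [A spA ->]||_ _ [A spA ->] [B spB ->]|_ [A spA ->]].
- exact/Sp4_unit/map_Sp4.
- by exists 1%:M; [apply: Sp4_1 | rewrite map_mx1].
- by exists (A *m B); [apply: Sp4_mul | rewrite map_mxM].
exists (adjsp A); first exact: Sp4_adjsp.
have spA' := map_Sp4 (intr : {rmorphism int -> rat}) spA.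
rewrite (map_adjsp (intr : {rmorphism int -> rat})).
by apply: adjsp_unique => //; rewrite mulmxV // Sp4_unit.
Qed.

(** By induction on the list of values, with excluded middle to decide whether
    a value is attained. *)
Lemma class_representatives (S : eqType) (T : finType) (cls : S -> T) (P : S -> Prop) :
  exists2 reps : seq S, forall r, r \in reps -> P r
    & forall x, P x -> exists2 r, r \in reps & cls r = cls x.
Proof.
suff [reps repsP cover] : exists2 reps : seq S, forall r, r \in reps -> P r
    & forall x, P x -> cls x \in enum T -> exists2 r, r \in reps & cls r = cls x.
  by exists reps => // x Px; apply: cover => //; rewrite mem_enum.
elim: (enum T) => [|c s [reps repsP cover]]; first by exists [::].
have [[y [Py yc]] | no_c] := classic (exists y, P y /\ cls y = c).
  exists (y :: reps) => [r | x Px].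
    by rewrite inE => /predU1P[-> | /repsP].
  rewrite inE => /predU1P[xc | /(cover _ Px)[r r_in rx]].
    by exists y; rewrite ?mem_head // yc xc.
  by exists r; rewrite // inE r_in orbT.
exists reps => // x Px; rewrite inE => /predU1P[xc | /(cover _ Px) //].
by case: no_c; exists x.
Qed.

(** Integral symplectic matrices congruent modulo [M] differ by a right factor
    congruent to 1, so residue matrices modulo [M] index the cosets. *)
Lemma congruence_finite_index (H : 'M[rat]_4 -> Prop) (M : int) :
  is_subgroup H -> (forall A, H A -> Sp4Z A) -> M != 0 ->
  (forall A, Sp4 A -> congr_one M A -> H (map_mx intr A)) ->
  finite_index_subgroup H Sp4Z.
Proof.
move=> subH H_Sp4Z M_n0 congrH; split=> //; first exact: Sp4Z_subgroup.
pose m := (absz M).-1.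
have residue x : (absz (x %% M)%Z < m.+1)%N.
  have := modz_ge0 x M_n0; have := ltz_mod x M_n0; rewrite /m; lia.
pose cls (A : 'M[int]_4) : 'M['I_m.+1]_4 := \matrix_(i, j) inord (absz (A i j %% M)%Z).
have cls_eq A B : cls A = cls B -> exists X, A = B + M *: X.
  move=> /matrixP eqAB; exists (\matrix_(i, j) ((A i j %/ M)%Z - (B i j %/ M)%Z)).
  apply/matrixP=> i j; have := congr1 val (eqAB i j); rewrite !mxE /= !inordK // => eq_ij.
  have := modz_ge0 (A i j) M_n0; have := modz_ge0 (B i j) M_n0.
  rewrite {2}(divz_eq (A i j) M) {2}(divz_eq (B i j) M).
  move: (A i j %% M)%Z (B i j %% M)%Z eq_ij => r s eq_rs s0 r0.
  have -> : r = s by lia.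
  by ring.
have [reps repsP cover] := class_representatives cls (@Sp4 int).
exists [seq map_mx intr r | r <- reps] => [_ /mapP[r /repsP spr ->]|_ [A spA ->]].
  by exists r.
have [r r_in /esym/cls_eq[X AE]] := cover A spA; have spr := repsP r r_in.
exists (map_mx intr r); first exact: map_f.
have -> : invmx (map_mx intr r) *m map_mx intr A = map_mx intr (adjsp r *m A) :> 'M[rat]_4.
  have spr' := map_Sp4 (intr : {rmorphism int -> rat}) spr.
  rewrite map_mxM (map_adjsp (intr : {rmorphism int -> rat})); congr (_ *m _).
  by apply: adjsp_unique => //; rewrite mulmxV // Sp4_unit.
apply: congrH; first by apply: Sp4_mul => //; apply: Sp4_adjsp.
by exists (adjsp r *m X); rewrite AE mulmxDr adjspK // scalemxAr.
Qed.

(** * The group of operator 250 *)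

Definition group_250 : 'M[rat]_4 -> Prop := conjugate T250 (Gamma op250).

Lemma group_250E : group_250 =
  conjugate (mx_of source_T250) (generated (map mx_of source_250)).
Proof. by rewrite /group_250 T250E /Gamma /= source_250E. Qed.

Lemma group_250_symplectic : symplectic_group group_250.
Proof. by rewrite group_250E; apply: conj_group frame_T250P. Qed.

Lemma eq_nth_mx_of (s t : seq qmx) i : all2 qeq s t ->
  mx_of (nth qid s i) = mx_of (nth qid t i).
Proof.
elim: s t i => [|A s IHs] [|B t] //= i /andP[eqAB eqst].
by case: i => [|i] /=; [apply: qeqP | apply: IHs].
Qed.

Lemma integral_250_in : all_in group_250 integral_250.
Proof.
move=> i; rewrite -(eq_nth_mx_of _ integral_250P) group_250E.
exact: conj_gens frame_T250P i.
Qed.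

(** The generators are integral in this frame, and the integral symplectic
    matrices form a group. *)
Lemma group_250_integral A : group_250 A -> Sp4Z A.
Proof.
have [_ _ Sp4ZM Sp4ZV] := Sp4Z_subgroup.
have [_ Sp4Z1 _ _] := Sp4Z_subgroup.
rewrite group_250E => -[B GB ->]; elim: GB => [|D sD|D E _ IHD _ IHE|D GD IHD].
- by rewrite mulmx1 mulVmx ?(frame_unit frame_T250P).
- have spD := conj_gen_Sp4 frame_T250P sD; case/mapP: sD spD => D' sD' ->.
  rewrite -(mx_of_conj frame_T250P) -(nth_index qid sD').
  have lt_i : (index D' source_250 < size source_250)%N by rewrite index_mem.
  rewrite -(nth_map _ qid) // (eq_nth_mx_of _ integral_250P).
  have : all (fun A => A.1 =? 1)%coqZ integral_250 by [].
  have size_eq : size integral_250 = size source_250 by [].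
  rewrite -size_eq in lt_i; move/(all_nthP qid)/(_ _ lt_i).
  case: (nth _ _ _) => d M /= /Z.eqb_spec ->; rewrite mx_of_int => spM.
  by exists (imx M) => //; apply: Sp4_intr.
- by rewrite (conjM frame_T250P); apply: Sp4ZM.
have spD := generated_Sp4 frame_T250P GD; rewrite (conjV frame_T250P spD).
set X := _ *m mx_of _ in spD IHD *; have <- : invmx X = adjsp X.
  by apply: adjsp_unique => //; rewrite mulmxV // Sp4_unit.
exact: Sp4ZV.
Qed.

Definition basis : 'M[int]_4 := imx basis_250.2.

Lemma Sp4_basis : Sp4 basis.
Proof.
apply: Sp4_intr; rewrite -mx_of_int; apply: adjsp_Sp4.
by rewrite -mx_of_adj -mx_of_mul -mx_of_id; apply: qeqP; vm_compute.
Qed.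

Definition rebased (A : 'M[int]_4) : 'M[int]_4 := basis *m A *m adjsp basis.

Lemma rebasedM A B : rebased (A *m B) = rebased A *m rebased B.
Proof.
by rewrite /rebased -!mulmxA (mulmxA (adjsp basis)) (adjspK Sp4_basis) mul1mx.
Qed.

Lemma rebased1 : rebased 1%:M = 1%:M.
Proof. by rewrite /rebased mulmx1 (adjspKr Sp4_basis). Qed.

(** Membership in the group, for a matrix written in the adapted basis. *)
Definition in_group_250 (A : 'M[int]_4) : Prop :=
  Sp4 A /\ group_250 (map_mx intr (rebased A)).

Lemma in_group_250_mul A B : in_group_250 A -> in_group_250 B -> in_group_250 (A *m B).
Proof.
have [_ _ mulG _] := group_250_symplectic.
case=> spA GA [spB GB]; split; first exact: Sp4_mul.
by rewrite rebasedM map_mxM; apply: mulG.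
Qed.

Lemma in_group_250_adj A : in_group_250 A -> in_group_250 (adjsp A).
Proof.
have [_ _ _ adjG] := group_250_symplectic.
case=> spA GA; split; first exact: Sp4_adjsp.
have spB := Sp4_basis; have spB' := Sp4_adjsp spB.
have -> : rebased (adjsp A) = adjsp (rebased A).
  rewrite /rebased !adjspM //; last exact: Sp4_mul.
  by rewrite (adjsp_inv spB) mulmxA.
by rewrite (map_adjsp (intr : {rmorphism int -> rat})); apply: adjG.
Qed.

Lemma mx_of_in_basis A B : mx_of A = map_mx intr B ->
  mx_of (in_basis A) = map_mx intr (rebased B).
Proof.
move=> AE; rewrite !mx_of_mul mx_of_adj mx_of_int AE -/basis /rebased.
by rewrite !map_mxM (map_adjsp (intr : {rmorphism int -> rat})) mulmxA.
Qed.

Lemma line_in_group_250 i A B : qeq (nth qid (run integral_250 program_250) i) (in_basis A) ->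
  Sp4 B -> mx_of A = map_mx intr B -> in_group_250 B.
Proof.
move=> /qeqP eqA spB AE; split=> //; rewrite -(mx_of_in_basis AE) -eqA.
exact (run_in group_250_symplectic program_250 integral_250_in i).
Qed.

Lemma zcol_basis : [/\ zcol [:: 1; 0; 0; 0]%coqZ = ve1 int, zcol [:: 0; 1; 0; 0]%coqZ = ve2 int,
  zcol [:: 0; 0; 1; 0]%coqZ = vf1 int & zcol [:: 0; 0; 0; 1]%coqZ = vf2 int].
Proof.
by split; apply/matrixP=> i j; rewrite !mxE; case: i => [] [|[|[|[|//]]]].
Qed.

Lemma levels_in_group_250 :
  [/\ in_group_250 (transv (-2) (ve1 int)), in_group_250 (transv 1024 (ve2 int)),
      in_group_250 (transv 8 (vf1 int)) & in_group_250 (transv (-8) (vf2 int))] /\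
  [/\ in_group_250 (short 64 (ve1 int) (ve2 int)), in_group_250 (short 8 (ve1 int) (vf2 int)),
      in_group_250 (short (-2048) (ve2 int) (vf1 int)) &
      in_group_250 (short 16 (vf1 int) (vf2 int))].
Proof.
have [ze1 ze2 zf1 zf2] := zcol_basis.
have long i k k' v : (i, qlong k v) \in levels_250 -> int_of_Z k = k' ->
    in_group_250 (transv k' (zcol v)).
  move=> lv <-; apply: line_in_group_250 (allP levels_250P _ lv) (Sp4_transv _ _) _.
  exact: mx_of_long.
have shrt i k k' v w : (i, qshort k v w) \in levels_250 -> int_of_Z k = k' ->
    size v = 4 -> size w = 4 -> spform (zcol v) (zcol w) = 0 ->
    in_group_250 (short k' (zcol v) (zcol w)).
  move=> lv <- sv sw vw0; apply: line_in_group_250 (allP levels_250P _ lv) _ _.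
    rewrite (short_transv _ vw0).
    exact: Sp4_mul (Sp4_mul (Sp4_transv _ _) (Sp4_transv _ _)) (Sp4_transv _ _).
  exact: mx_of_short.
split; split; rewrite -?ze1 -?ze2 -?zf1 -?zf2.
- by apply: (long 10%N (-2)%coqZ).
- by apply: (long 65%N 1024%coqZ).
- by apply: (long 0%N 8%coqZ).
- by apply: (long 9%N (-8)%coqZ).
- by apply: (shrt 66%N 64%coqZ) => //; rewrite ze1 ze2 formE.
- by apply: (shrt 68%N 8%coqZ) => //; rewrite ze1 zf2 formE.
- by apply: (shrt 69%N (-2048)%coqZ) => //; rewrite ze2 zf1 formE.
- by apply: (shrt 71%N 16%coqZ) => //; rewrite zf1 zf2 formE.
Qed.

Lemma in_group_250_1 : in_group_250 1%:M.
Proof.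
have [_ G1 _ _] := group_250_symplectic.
by split; [apply: Sp4_1 | rewrite rebased1 map_mx1].
Qed.

Lemma root_in_group_250 t A : root_element (2048 * t) A -> in_group_250 A.
Proof.
have [[le1 le2 lf1 lf2] [le1e2 le1f2 le2f1 lf1f2]] := levels_in_group_250.
have long k c v : in_group_250 (transv k v) -> 2048 = k * c ->
    in_group_250 (transv (2048 * t) v).
  move=> Ck ->; rewrite -mulrA.
  exact: transv_multiples in_group_250_1 in_group_250_mul in_group_250_adj _ _ Ck _.
have shrt k c v w : in_group_250 (short k v w) -> spform v w = 0 -> 2048 = k * c ->
    in_group_250 (short (2048 * t) v w).
  move=> Ck vw0 ->; rewrite -mulrA.
  exact: short_multiples in_group_250_1 in_group_250_mul in_group_250_adj _ _ _ vw0 Ck _.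
case.
- by apply: (long _ (-1024) _ le1).
- by apply: (long _ 2 _ le2).
- by apply: (long _ 256 _ lf1).
- by apply: (long _ (-256) _ lf2).
- by apply: (shrt _ 32 _ _ le1e2); rewrite ?formE.
- by apply: (shrt _ 256 _ _ le1f2); rewrite ?formE.
- by apply: (shrt _ (-1) _ _ le2f1); rewrite ?formE.
- by apply: (shrt _ 128 _ _ lf1f2); rewrite ?formE.
Qed.

Lemma e1_in_group_250 t : in_group_250 (transv (2 * t) (ve1 int)).
Proof.
have [[le1 _ _ _] _] := levels_in_group_250.
have := transv_multiples in_group_250_1 in_group_250_mul in_group_250_adj le1 (- t).
by rewrite mulrNN.
Qed.

Lemma ford_in_group_250 a b c d : (a, b, c, d) \in ford_sides ->
  in_group_250 (plane a b c d).
Proof.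
move=> abcd; have det1 : a * d - b * c = 1.
  have /allP/(_ _ abcd)/eqP : all (fun q : int * int * int * int =>
    q.1.1.1 * q.2 - q.1.1.2 * q.1.2 == 1) ford_sides by [].
  by [].
move: abcd; rewrite -planes_ford_sides => /mapP[[i [[[a' b'] c'] d']] in_planes [aE bE cE dE]].
apply: line_in_group_250 (allP planes_250P _ in_planes) (Sp4_plane det1) _.
by rewrite mx_of_plane aE bE cE dE.
Qed.

(** The congruence condition is insensitive to the change of integral basis, so
    [congruence_fill] applies to the conjugate [A'] of [A]; it yields an
    inverse of [A'] in the group. *)
Lemma congruence_in_group_250 A : Sp4 A -> congr_one (2048 ^+ 2) A ->
  group_250 (map_mx intr A).
Proof.
move=> spA [X AE]; have spb := Sp4_basis; have spb' := Sp4_adjsp spb.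
pose A' := adjsp basis *m A *m basis.
have spA' : Sp4 A' by do !apply: Sp4_mul.
have congrA' : congr_one (2048 ^+ 2) A'.
  exists (adjsp basis *m X *m basis).
  by rewrite /A' AE mulmxDr mulmx1 mulmxDl (adjspK spb) scalemxAl scalemxAr.
have [] := @congruence_fill in_group_250 2048 _ in_group_250_mul _
  root_in_group_250 e1_in_group_250 _ A' spA' congrA'.
- by [].
- by move=> B [].
- move=> a c Na Nc; apply: (plane_reduce in_group_250_mul e1_in_group_250 ford_in_group_250).
  + by apply: dvdz_trans Na.
  + by apply: dvdz_trans Nc.
move=> B [spB GB] BA'.
have BA : rebased B *m A = 1%:M.
  rewrite -rebased1 -BA' rebasedM; congr (_ *m _).
  by rewrite /rebased /A' !mulmxA (adjspKr spb) mul1mx -mulmxA (adjspKr spb) mulmx1.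
have spB' : Sp4 (rebased B) by apply: Sp4_mul => //; apply: Sp4_mul.
have [_ _ _ adjG] := group_250_symplectic.
rewrite (adjsp_unique spB' BA) (map_adjsp (intr : {rmorphism int -> rat})).
exact: adjG.
Qed.

Lemma group_250_finite_index : finite_index_subgroup group_250 Sp4Z.
Proof.
have [spG G1 mulG adjG] := group_250_symplectic.
apply: (@congruence_finite_index _ (2048 ^+ 2)).
- split=> [A /spG/Sp4_unit //|//|//|A GA].
  suff -> : invmx A = adjsp A by apply: adjG.
  by apply: adjsp_unique; [exact: spG | rewrite mulmxV // (Sp4_unit (spG _ GA))].
- exact: group_250_integral.
- by [].
exact: congruence_in_group_250.
Qed.

Lemma certified_density P Pi s D : frame_check P Pi s -> density_check P Pi s D ->
  exists T : 'M[rat]_4, [/\ T \in unitmx,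
    forall A, conjugate T (generated (map mx_of s)) A -> Sp4 A
    & zariski_dense_in_Sp4 (conjugate T (generated (map mx_of s)))].
Proof.
move=> chk dns; exists (mx_of P); split; first exact: frame_unit chk.
  by have [] := conj_group chk.
exact: density_cert chk dns.
Qed.

Theorem mainTheorem1 :
  [/\ (* (1) *)
      forall j : orphan_operator,
        exists T : 'M[rat]_4,
          [/\ T \in unitmx,
              forall A, conjugate T (Gamma j) A -> Sp4 A
            & zariski_dense_in_Sp4 (conjugate T (Gamma j))],
      (* (2) *)
      forall j : orphan_operator, j <> op35 ->
        exists2 A : 'M[rat]_4, Gamma j A & maximally_unipotent A
    & (* (3) *)
      finite_index_subgroup (conjugate T250 (Gamma op250)) Sp4Z].
Proof.
split; last exact: group_250_finite_index.
- case; rewrite /Gamma /generators.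
  + rewrite source_33E; exact: certified_density frame_33P density_33P.
  + rewrite source_35E; exact: certified_density frame_35P density_35P.
  + rewrite source_97E; exact: certified_density frame_97P density_97P.
  + rewrite source_152E; exact: certified_density frame_152P density_152P.
  + rewrite source_153E; exact: certified_density frame_153P density_153P.
  + rewrite source_243E; exact: certified_density frame_243P density_243P.
  + rewrite source_248E; exact: certified_density frame_248P density_248P.
  + rewrite source_250E; exact: certified_density frame_250P density_250P.
  + rewrite source_266E; exact: certified_density frame_266P density_266P.
case=> // _; rewrite /Gamma /generators.
- rewrite source_33E; exact: unipotent_cert frame_33P unipotent_33P.
- rewrite source_97E; exact: unipotent_cert frame_97P unipotent_97P.
- rewrite source_152E; exact: unipotent_cert frame_152P unipotent_152P.
- rewrite source_153E; exact: unipotent_cert frame_153P unipotent_153P.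
- rewrite source_243E; exact: unipotent_cert frame_243P unipotent_243P.
- rewrite source_248E; exact: unipotent_cert frame_248P unipotent_248P.
- rewrite source_250E; exact: unipotent_cert frame_250P unipotent_250P.
- rewrite source_266E; exact: unipotent_cert frame_266P unipotent_266P.
Qed.
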